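(* Let $0<s<\tfrac12$ and set $\theta=\frac{1-2s}{1-s}$. Then there exist a closed set $E\subset\mathbb T$ of Lebesgue measure zero and a nonatomic singular probability measure $\mu$ supported on $E$ such that $$\sum_J |J|^\theta<\infty,$$ where the sum is taken over all complementary arcs $J$ of $E$ (the connected components of $\mathbb T\setminus E$), and such that for every nonzero finite positive Borel measure $\nu$ on $\mathbb T$ satisfying $0<\nu\le\mu$, $$S_\nu'\notin H^s.$$
   Context: $\mathbb D$ is the open unit disk in $\mathbb C$ and $\mathbb T=\partial\mathbb D$, identified with $\mathbb R/\mathbb Z$ via $x\mapsto e^{2\pi i x}$. $|J|$ denotes normalized arc length (so $|\mathbb T|=1$). ''Singular'' means singular with respect to Lebesgue measure on $\mathbb T$. For positive measures, $\nu\le\mu$ means $\nu(A)\le\mu(A)$ for all Borel sets $A$, and $0<\nu$ means $\nu$ is nonzero. For a finite positive singular measure $\sigma$ on $\mathbb T$, the associated singular inner function is $$S_\sigma(z)=\exp\Bigl(-\int_{\mathbb T}\frac{\xi+z}{\xi-z}\,d\sigma(\xi)\Bigr),\qquad z\in\mathbb D.$$ $H^s$ is the Hardy space on $\mathbb D$: holomorphic $f$ with $\sup_{0<r<1}\int_{\mathbb T}|f(r\xi)|^s\,|d\xi|<\infty$. *)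

(* Defs.v *)
(* MathComp-Analysis, over an arbitrary [R : realType]. *)
From HB Require Import structures.
From mathcomp Require Import all_boot all_order all_algebra.
From mathcomp Require Import all_classical all_reals all_analysis.
From mathcomp Require Import complex.

Set Implicit Arguments.
Unset Strict Implicit.
Unset Printing Implicit Defensive.

Import Order.TTheory GRing.Theory Num.Theory numFieldNormedType.Exports.

Local Open Scope classical_set_scope.
Local Open Scope ring_scope.
Local Open Scope complex_scope.

(* R[i] packed as a numFieldType: topology, limits and [derive1] (here the
   complex derivative) are attached by the library to such a packed type, not
   to the bare type R[i]. *)
Definition cplx (R : realType) : numFieldType := R[i].

Definition cexp (R : realType) (z : cplx R) : cplx R :=
  (expR (complex.Re z))%:C * (cos (complex.Im z) +i* sin (complex.Im z)).

Definition unit_disk (R : realType) : set (cplx R) := [set z | `|z| < 1].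

Definition unit_circle (R : realType) : set (cplx R) := [set z | `|z| = 1].

Definition circle (R : realType) : Type := set_type (@unit_circle R).

Definition circle_val (R : realType) (xi : circle R) : cplx R := set_val xi.

Lemma circle_param_subproof (R : realType) (x : R) :
  (cos (2 * pi * x) +i* sin (2 * pi * x) : cplx R) \in @unit_circle R.
Proof.
by apply/mem_set; rewrite /unit_circle /= normc_def /= cos2Dsin2 sqrtr1.
Qed.

(* x |-> exp(2 i pi x) *)
Definition circle_param (R : realType) (x : R) : circle R :=
  exist _ (cos (2 * pi * x) +i* sin (2 * pi * x)) (circle_param_subproof x).

(* The circle carries the topology induced by the plane, and its Borel
   sigma-algebra. *)
HB.instance Definition _ (R : realType) :=
  Topological.copy (circle R) (set_type (@unit_circle R)).
HB.instance Definition _ (R : realType) :=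
  isPointed.Build (circle R) (circle_param 0).
HB.instance Definition _ (R : realType) :=
  @isMeasurable.Build (sigma_display (@open (circle R))) (circle R)
    <<s @open (circle R) >> (@sigma_algebra0 _ setT _)
    (@sigma_algebraC _ _) (@sigma_algebra_bigcup _ setT _).

Lemma circle_param_continuous (R : realType) : continuous (@circle_param R).
Proof.
have cvg_lin (f : R -> R) (x : R) : continuous f ->
    f (2 * pi * y) @[y --> x] --> f (2 * pi * x).
  move=> cf; apply: continuous_comp; last exact: cf.
  by apply: cvgM; [exact: cvg_cst|exact: cvg_id].
have cE : continuous (fun x : R => circle_val (circle_param x)).
  move=> x; apply/cvgrPdist_lt => -[e e'] /= /[dup] e0.
  rewrite ltcE /= => /andP[/eqP e'0 e_gt0].
  have e2_gt0 : 0 < e / 2 by rewrite divr_gt0.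
  have /cvgrPdist_lt/(_ _ e2_gt0) cosx := cvg_lin _ x (@continuous_cos R).
  have /cvgrPdist_lt/(_ _ e2_gt0) sinx := cvg_lin _ x (@continuous_sin R).
  near=> y; rewrite e'0 normc_def ltcR /=.
  have : `|cos (2 * pi * x) - cos (2 * pi * y)| < e / 2 by near: y.
  have : `|sin (2 * pi * x) - sin (2 * pi * y)| < e / 2 by near: y.
  move: (cos _ - _) (sin _ - _) => a b hb ha.
  apply: (@le_lt_trans _ _ (`|a| + `|b|)); last first.
    by rewrite [ltRHS]splitr ltrD.
  rewrite -[leRHS]ger0_norm ?addr_ge0// -sqrtr_sqr ler_wsqrtr//.
  rewrite sqrrD !real_normK ?num_real// addrAC lerDl.
  by rewrite mulrn_wge0// mulr_ge0.
apply/continuousP => A [B oB <-].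
by move/continuousP : cE => /(_ _ oB).
Unshelve. all: by end_near.
Qed.

Lemma measurable_circle_param (R : realType) :
  measurable_fun [set: measurableTypeR R] (@circle_param R).
Proof.
apply: (@measurability _ _ _ _ _ _ (@open (circle R))) => //.
move=> _ [A oA <-]; rewrite setTI; apply: measurable_realfun.open_measurable.
by move/continuousP : (@circle_param_continuous R) => /(_ _ oA).
Qed.

(* Normalized arc length: the image of the Lebesgue measure of [0, 1[. *)
Definition arclength (R : realType) : set (circle R) -> \bar R :=
  pushforward
    (mrestr (@lebesgue_measure R) (measurable_itv `[0, 1[))
    (@circle_param R).

Section arclength_probability.
Variable R : realType.
Local Open Scope ereal_scope.

Let mu : {measure set measurableTypeR R -> \bar R} :=
  mrestr (@lebesgue_measure R) (measurable_itv `[0%R, 1%R[).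

Let image_mu : {measure set (circle R) -> \bar R} :=
  measure_function_pushforward__canonical__measure_function_Measure
    mu (@measurable_circle_param R).

Let arclength0 : @arclength R set0 = 0.
Proof. exact: (measure0 image_mu). Qed.

Let arclength_ge0 A : 0 <= @arclength R A.
Proof. exact: (measure_ge0 image_mu). Qed.

Let arclength_sigma_additive : semi_sigma_additive (@arclength R).
Proof. exact: (@measure_semi_sigma_additive _ _ _ image_mu). Qed.

HB.instance Definition _ := isMeasure.Build _ _ _ (@arclength R)
  arclength0 arclength_ge0 arclength_sigma_additive.

Let arclength_setT : @arclength R setT = 1.
Proof.
rewrite /arclength /pushforward preimage_setT /mrestr setTI.
by rewrite lebesgue_measure_itv /= lte_fin ltr01 oppr0 adde0.
Qed.

HB.instance Definition _ := Measure_isProbability.Build _ _ _ (@arclength R)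
  arclength_setT.

End arclength_probability.

Definition complementary_arcs (R : realType) (E : set (circle R)) :
    set (set (circle R)) :=
  [set connected_component (~` E) xi | xi in ~` E].

Section measures_on_the_circle.
Context (R : realType).
Implicit Types mu nu : {measure set (circle R) -> \bar R}.
Local Open Scope ereal_scope.

Definition singular mu :=
  exists N, [/\ measurable N, arclength N = 0 & mu (~` N) = 0].

Definition nonatomic mu := forall xi : circle R, mu [set xi] = 0.

Definition supported_on mu (E : set (circle R)) := mu (~` E) = 0.

Definition measure_le nu mu := forall A, measurable A -> nu A <= mu A.

Definition measure_nonzero nu := exists2 A, measurable A & nu A != 0.

End measures_on_the_circle.

Definition cintegral (R : realType) (mu : {measure set (circle R) -> \bar R})
    (f : circle R -> cplx R) : cplx R :=
  (\int[mu]_xi complex.Re (f xi)) +i* (\int[mu]_xi complex.Im (f xi)).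

(* Only meant for |z| < 1, where the integrand is bounded and continuous. *)
Definition singular_inner (R : realType)
    (sigma : {measure set (circle R) -> \bar R}) (z : cplx R) : cplx R :=
  cexp (- cintegral sigma
          (fun xi => (circle_val xi + z) / (circle_val xi - z))).

Definition holomorphic_disk (R : realType) (f : cplx R -> cplx R) :=
  forall z, unit_disk z -> derivable f z 1.

(* The norm of cplx R takes values in cplx R, hence the [Re]. *)
Definition hardy (R : realType) (s : R) (f : cplx R -> cplx R) :=
  holomorphic_disk f /\
  (ereal_sup [set \int[@arclength R]_xi
                    (complex.Re `|f (r%:C * circle_val xi)%R|%R `^ s)%:E
             | r in `]0%R, 1%R[ ] < +oo)%E.

(* Main.v *)
Require Import Defs.
From HB Require Import structures.
From mathcomp Require Import all_boot all_order all_algebra.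
From mathcomp Require Import all_classical all_reals all_analysis.
From mathcomp Require Import measurable_realfun complex zify ring lra.

Set Implicit Arguments.
Unset Strict Implicit.
Unset Printing Implicit Defensive.

Import Order.TTheory GRing.Theory Num.Theory numFieldNormedType.Exports.

Local Open Scope classical_set_scope.
Local Open Scope ring_scope.

(** The set E is a Cantor set whose lengths sit exactly at the critical rate,
    and mu is the uniform measure on it.  At generation n there are 2^n
    intervals of length
      l_n = (2^(n(1-s)) (n+1))^(-1/(1-2s)),
    and the gap removed from the middle of each of them has length
    g_n = l_n - 2 l_(n+1), which is comparable with l_n because
    2 l_(n+1) <= rho l_n with rho < 1 ([critical_length_ratio]).  The
    exponent theta is the one for which l_n^theta = 2^-n (n+1)^(-1/(1-s)), so
    that the sum over all gaps is at most
      sum_n 2^n l_n^theta = sum_n (n+1)^(-1/(1-s)) < oo.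

    For a measure nu, put H(z) for the integral of (zeta + z) / (zeta - z), so
    that S_nu = exp(-H) and S_nu' = - S_nu H' ([singular_inner_derive1]).
    Suppose that nu is carried by E, and let xi run over the middle half of the
    gap removed from an interval I of generation n.  There xi stays away from
    E, so |S_nu(r xi)| is bounded below for r close to 1, and the kernel of
    H'(r xi), once multiplied by xi, has a negative real part of size
    1 / |zeta - xi|^2.  No cancellation occurs, and
      |S_nu'(r xi)| >= c nu(I) / l_n^2      ([singular_inner_derive1_ge]).
    Summing over the gaps of generation less than N, for r close to 1,
      int |S_nu'(r xi)|^s >= c sum_(n < N) g_n l_n^(-2s) sum_I nu(I)^s.

    The hypothesis nu <= mu is used through nu(I) <= 3 / 2^n.  As s < 1, it
    gives nu(I)^s >= (3 / 2^n)^(s-1) nu(I), and summing over I,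
      sum_I nu(I)^s >= (3 / 2^n)^(s-1) nu(T):
    up to a constant factor, every nonzero nu does as well as mu itself.  What
    remains is ([radial_integral_ge], [critical_length_harmonic])
      sum_(n < N) l_n^(1-2s) 2^(n(1-s)) = sum_(n < N) 1/(n+1),
    which is unbounded. *)

(** * The circle as a quotient of the line *)

Section circle_parametrization.
Context {R : realType}.
Implicit Types (x y t a b : R) (xi : circle R).

Lemma cos_2pi_lt1 t : 0 < t < 1 -> cos (2 * pi * t) < 1.
Proof.
move=> /andP[t0 t1]; have -> : 2 * pi * t = (pi * t) *+ 2 by rewrite mulr2n; lra.
have s : 0 < sin (pi * t).
  by apply: sin_gt0_pi; rewrite mulr_gt0 ?pi_gt0//= gtr_pMr ?pi_gt0.
have := cos2Dsin2 (pi * t); rewrite mulr2n cosD -!expr2.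
by have := exprn_gt0 2 s; lra.
Qed.

Lemma cos_circle_param_eq x y : circle_param x = circle_param y ->
  cos (2 * pi * (x - y)) = 1.
Proof.
move=> /(congr1 (@circle_val R)) [] cE sE.
by rewrite mulrBr cosB cE sE -!expr2 cos2Dsin2.
Qed.

Lemma circle_param_inj x y : `|x - y| < 1 ->
  circle_param x = circle_param y -> x = y.
Proof.
wlog yx : x y / y <= x => [hw xy1 xyE|].
  have [/hw|/ltW/hw] := leP y x; first exact.
  by move=> ->//; rewrite distrC.
rewrite ger0_norm ?subr_ge0// => xy1 /cos_circle_param_eq cE.
apply/eqP; rewrite eq_le yx andbT leNgt; apply/negP => ltyx.
have : cos (2 * pi * (x - y)) < 1 by apply: cos_2pi_lt1; rewrite xy1 subr_gt0 ltyx.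
by rewrite cE ltxx.
Qed.

Lemma circle_paramD1 x : circle_param (x + 1) = circle_param x.
Proof.
apply/val_inj => /=; have -> : 2 * pi * (x + 1) = 2 * pi * x + pi *+ 2.
  by rewrite mulr2n; lra.
by rewrite cosD2pi sinD2pi.
Qed.

Lemma circle_param_surj xi : exists2 x, 0 <= x < 1 & circle_param x = xi.
Proof.
have pi0 := pi_gt0 R.
case: xi => -[c s] cs1; have := cs1 => /set_mem; rewrite /unit_circle /= normc_def => -[] /= h.
have {}h : c ^+ 2 + s ^+ 2 = 1.
  by apply/eqP; rewrite -(eqr_sqrt _ ler01) ?addr_ge0 ?sqr_ge0// h sqrtr1.
have s2 := sqr_ge0 s; have c1 : -1 <= c <= 1.
  by apply/andP; split; nra.
have c1' : c \in `[(-1), 1] by rewrite in_itv.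
have sE : sin (acos c) = `|s|.
  by rewrite sin_acos// -h addrAC subrr add0r sqrtr_sqr.
have [s0|s0] := leP 0 s.
  exists (acos c / (2 * pi)).
    apply/andP; split; first by rewrite divr_ge0 ?acos_ge0// mulr_ge0// ltW.
    by rewrite ltr_pdivrMr ?mulr_gt0//; have := acos_lepi c1; lra.
  have xE : 2 * pi * (acos c / (2 * pi)) = acos c.
    by rewrite mulrC divfK// gt_eqF// mulr_gt0.
  by apply/val_inj; rewrite /= xE acosK// sE ger0_norm.
exists (1 - acos c / (2 * pi)).
  have a0 : 0 < acos c.
    apply: acos_gt0; case/andP: c1 => -> /=; rewrite le_eqVlt => /predU1P[ce|//].
    by move: h; rewrite ce; nra.
  have : 0 < acos c / (2 * pi) by rewrite divr_gt0// mulr_gt0.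
  have : acos c / (2 * pi) < 1.
    by rewrite ltr_pdivrMr ?mulr_gt0//; have := acos_lepi c1; lra.
  lra.
have xE : 2 * pi * (1 - acos c / (2 * pi)) = - acos c + pi *+ 2.
  rewrite mulrBr [X in _ - X]mulrC divfK ?gt_eqF ?mulr_gt0// mulr1 addrC.
  by rewrite mulr2n; lra.
by apply/val_inj; rewrite /= xE cosD2pi sinD2pi cosN sinN acosK// sE ltr0_norm// opprK.
Qed.

Lemma hausdorff_circle : hausdorff_space (circle R).
Proof.
have hC : hausdorff_space (cplx R) by exact: norm_hausdorff.
rewrite open_hausdorff => x y xy.
have : set_val x != set_val y :> cplx R.
  by apply: contra xy => /eqP /val_inj ->.
move: hC; rewrite open_hausdorff => /[apply] -[[A B] /= [xA yB] [oA oB AB]].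
exists (set_val @^-1` A, set_val @^-1` B) => /=.
  by split; apply/mem_set; [move/set_mem: xA|move/set_mem: yB].
split; [by exists A|by exists B|].
by rewrite /= -preimage_setI (eqP AB) preimage_set0.
Qed.

(** Arcs are closed as images of compact segments, which avoids the
    description of the induced topology. *)
Lemma closed_circle_arc a b : closed (@circle_param R @` `[a, b]).
Proof.
apply: compact_closed; first exact: hausdorff_circle.
apply: continuous_compact; last exact: segment_compact.
by apply: continuous_subspaceT; exact: circle_param_continuous.
Qed.

(** An open arc shorter than the whole circle is the complement of the closed
    arc that runs from its right end once around to its left end. *)
Lemma open_circle_arc a b : 0 <= a -> b <= 1 -> open (@circle_param R @` `]a, b[).
Proof.
move=> a0 b1.
have -> : @circle_param R @` `]a, b[ =
    if a < b then ~` (@circle_param R @` `[b, a + 1]) else set0.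
  case: ifPn => [ab|]; last first.
    by rewrite -leNgt => ba; rewrite set_itv_ge ?image_set0// bnd_simp -leNgt.
  apply/seteqP; split => [_ [x /= + <-]|xi nxi] /=.
    rewrite in_itv/= => /andP[ax xb] [y /= + yx]; rewrite in_itv/= => /andP[by_ ya].
    have /esym: y = x; last by lra.
    apply: circle_param_inj => //; rewrite ger0_norm; lra.
  have [x /andP[x0 x1] xE] := circle_param_surj xi.
  have [ax|xa] := ltP a x; last first.
    exfalso; apply: nxi; exists (x + 1); last by rewrite circle_paramD1.
    by rewrite /= in_itv/=; apply/andP; split; lra.
  exists x => //; rewrite in_itv/= ax/= ltNge; apply/negP => bx.
  by apply: nxi; exists x => //; rewrite /= in_itv/= bx/=; lra.
case: ifP => _; last exact: open0.
by apply: closed_openC; exact: closed_circle_arc.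
Qed.

Lemma open_measurable_circle (A : set (circle R)) : open A -> measurable A.
Proof. by move=> oA; exact: sub_sigma_algebra. Qed.

Lemma closed_measurable_circle (A : set (circle R)) : closed A -> measurable A.
Proof.
by move=> cA; rewrite -(setCK A); apply: measurableC; apply: open_measurable_circle; exact: closed_openC.
Qed.

Lemma arclength_le (A : set (circle R)) (B : set R) : measurable A ->
  measurable B -> @circle_param R @^-1` A `&` `[0, 1[ `<=` B ->
  (arclength A <= @lebesgue_measure R B)%E.
Proof.
move=> mA mB AB; rewrite /arclength /pushforward /mrestr.
apply: le_measure => //; rewrite inE//.
by apply: measurableI => //; rewrite -[X in measurable X]setTI; exact: measurable_circle_param.
Qed.

Lemma arclength_ge (A : set (circle R)) (B : set R) : measurable A ->
  measurable B -> B `<=` @circle_param R @^-1` A `&` `[0, 1[ ->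
  (@lebesgue_measure R B <= arclength A)%E.
Proof.
move=> mA mB AB; rewrite /arclength /pushforward /mrestr.
apply: le_measure => //; rewrite inE//.
by apply: measurableI => //; rewrite -[X in measurable X]setTI; exact: measurable_circle_param.
Qed.

Lemma arclength_arc_le a b : 0 <= a -> a <= b -> b <= 1 ->
  (arclength (@circle_param R @` `]a, b[) <= (b - a)%:E)%E.
Proof.
move=> a0 ab b1; apply: (@le_trans _ _ (@lebesgue_measure R `]a, b[)).
  apply: arclength_le => //.
    by apply: open_measurable_circle; exact: open_circle_arc.
  move=> x [] /= [y /=]; rewrite !in_itv/= => /andP[ay yb] yx /andP[x0 x1].
  suff <- : y = x by rewrite ay.
  by apply: circle_param_inj => //; rewrite ltr_norml; lra.
by rewrite lebesgue_measure_itv /= lte_fin; case: ifPn => // _; rewrite lee_fin subr_ge0.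
Qed.

Lemma arclength_arc_ge a b : 0 <= a -> a <= b -> b < 1 ->
  ((b - a)%:E <= arclength (@circle_param R @` `[a, b]))%E.
Proof.
move=> a0 ab b1; apply: (@le_trans _ _ (@lebesgue_measure R `[a, b])).
  rewrite lebesgue_measure_itv /= lte_fin; case: ifPn => //; rewrite -leNgt lee_fin => ?; lra.
apply: arclength_ge => //; first by apply: closed_measurable_circle; exact: closed_circle_arc.
move=> x /=; rewrite !in_itv/= => xab; split; first by exists x => //=; rewrite in_itv.
lra.
Qed.

End circle_parametrization.

(** * The critical lengths *)

Section critical_series.
Context {R : realType}.
Implicit Types q s : R.

(** One step of the comparison of the sum of n^-(1+q) with the telescoping sum
    of n^-q.  After division by n.+2^-q it is 1 + q/y <= (y/x)^q with
    y = x + 1, that is exp(u) >= 1 + u at u = q ln(y/x), where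
    ln(y/x) = - ln(1 - 1/y) >= 1/y. *)
Lemma riemannR_telescope q n : 0 < q ->
  q * (n.+2%:R `^ (1 + q))^-1 <= (n.+1%:R `^ q)^-1 - (n.+2%:R `^ q)^-1 :> R.
Proof.
move=> q0; set x : R := n.+1%:R; set y : R := n.+2%:R.
have x0 : 0 < x by rewrite ltr0n.
have y0 : 0 < y by rewrite ltr0n.
have yx : y = x + 1 by rewrite /y /x -natr1.
clearbody x y.
have xq : 0 < x `^ q by exact: powR_gt0.
have yq : 0 < y `^ q by exact: powR_gt0.
have lnyx : y^-1 <= ln y - ln x.
  have : ln (1 + (- y^-1)) <= - y^-1.
    by apply: le_ln1Dx; rewrite ltrN2 invf_lt1// yx ltrDr.
  have -> : 1 - y^-1 = x / y.
    by rewrite -[X in X - _](divff (lt0r_neq0 y0)) -{2}(mul1r y^-1) -mulrBl yx addrK.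
  by rewrite ln_div ?posrE//; lra.
have h : 1 + q / y <= y `^ q / x `^ q.
  rewrite /powR !gt_eqF// -expRB -mulrBr.
  apply: le_trans (expR_ge1Dx _); rewrite lerD2l.
  by rewrite ler_pM2l.
rewrite powRD; last by rewrite [X in _ ==> ~~ X]gt_eqF// implybT.
rewrite powRr1 ?(ltW y0)// -(ler_pM2l yq) mulrBr divff ?gt_eqF//.
by rewrite invfM mulrC -!mulrA mulVf ?gt_eqF// mulr1; lra.
Qed.

Lemma riemannR_bounded q n : 0 < q ->
  \sum_(0 <= i < n) riemannR (1 + q) i <= 1 + q^-1.
Proof.
move=> q0.
have key m : \sum_(0 <= i < m.+1) riemannR (1 + q) i <=
    1 + q^-1 * (1 - (m.+1%:R `^ q)^-1).
  elim: m => [|m IH].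
    by rewrite big_nat1 /riemannR !powR1 invr1 subrr mulr0 addr0.
  rewrite big_nat_recr//=; have := riemannR_telescope m q0.
  rewrite -(@ler_pM2l _ q^-1) ?invr_gt0// mulKf ?gt_eqF// => h.
  have := lerD IH h; move/le_trans; apply; rewrite -addrA lerD2l -mulrDr.
  by rewrite ler_pM2l ?invr_gt0//; lra.
case: n => [|m]; first by rewrite big_geq// addr_ge0// invr_ge0 ltW.
apply: (le_trans (key m)); rewrite lerD2l ler_piMr ?invr_ge0 ?(ltW q0) ?gerBl ?invr_ge0 ?powR_ge0//.
Qed.

Lemma harmonic_unbounded (M : R) : exists n, M < \sum_(0 <= i < n) harmonic i.
Proof.
apply: contrapT => /forallNP h; apply: (@dvg_harmonic R).
apply: nondecreasing_is_cvgn.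
  by apply/nondecreasing_seqP => n; rewrite /series /= big_nat_recr//= lerDl invr_ge0.
by exists M => _ [n _ <-]; rewrite leNgt; apply/negP; exact: h.
Qed.

(** The solution l of l^(1-2s) 2^(n(1-s)) = 1/(n+1). *)
Definition critical_length s n : R :=
  ((2 ^+ n) `^ (1 - s) * n.+1%:R) `^ (- (1 - 2 * s)^-1).

Context (s : R) (s_gt0 : 0 < s) (s_lt_half : s < 1 / 2).

Let tau0 : 0 < 1 - 2 * s. Proof. by move: s_lt_half; lra. Qed.

Let weight_gt0 n : 0 < (2 ^+ n) `^ (1 - s) * n.+1%:R :> R.
Proof. by rewrite mulr_gt0// powR_gt0// exprn_gt0. Qed.

Lemma critical_length0 : critical_length s 0 = 1.
Proof. by rewrite /critical_length expr0 !powR1 mul1r powR1. Qed.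

Lemma critical_length_gt0 n : 0 < critical_length s n.
Proof. by rewrite powR_gt0. Qed.

Definition critical_ratio : R := 2 `^ (- (s / (1 - 2 * s))).

Lemma critical_ratio_lt1 : 0 < critical_ratio < 1.
Proof.
rewrite /critical_ratio powR_gt0//= powRN invf_lt1 ?powR_gt0//.
by rewrite -[X in X < _](powRr0 2) /powR !gt_eqF// ltr_expR ltr_pM2r ?divr_gt0// ln_gt0// ltr1n.
Qed.

Lemma critical_length_ratio n :
  2 * critical_length s n.+1 <= critical_ratio * critical_length s n.
Proof.
have -> : critical_ratio = 2 * (2 `^ (1 - s)) `^ (- (1 - 2 * s)^-1).
  rewrite -[X in X * _](@powRr1 _ 2)// -powRrM -powRD ?pnatr_eq0 ?implybT//.
  by congr powR; field; rewrite gt_eqF.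
rewrite -mulrA ler_pM2l// /critical_length -powRM ?powR_ge0 ?(ltW (weight_gt0 n))//.
rewrite !powRN lef_pV2 ?posrE ?powR_gt0 ?mulr_gt0 ?powR_gt0//.
apply: ge0_ler_powR; rewrite ?nnegrE ?invr_ge0 ?(ltW tau0)//.
rewrite exprS powRM ?exprn_ge0// -mulrA ler_pM2l ?powR_gt0//.
by rewrite ler_pM2l ?powR_gt0 ?exprn_gt0// ler_nat.
Qed.

(** The exponent on the left is theta, and 1 + s/(1-s) = 1/(1-s) is greater
    than 1: this is the convergent side of criticality. *)
Lemma critical_length_content n :
  2 ^+ n * critical_length s n `^ ((1 - 2 * s) / (1 - s)) = riemannR (1 + s / (1 - s)) n.
Proof.
have s1 : 0 < 1 - s by move: s_lt_half; lra.
rewrite /critical_length -powRrM.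
have -> : - (1 - 2 * s)^-1 * ((1 - 2 * s) / (1 - s)) = - (1 - s)^-1.
  by field; rewrite !gt_eqF.
rewrite powRM ?powR_ge0// -powRrM mulrN divff ?gt_eqF// powR_inv1 ?exprn_ge0//.
rewrite mulrA divff ?gt_eqF ?exprn_gt0// mul1r powRN; congr ((_ `^ _)^-1).
by field; rewrite gt_eqF.
Qed.

(** The divergent side: the radial means produce g_n l_n^(-2s), and g_n is
    comparable with l_n. *)
Lemma critical_length_harmonic n :
  critical_length s n `^ (1 - 2 * s) * (2 ^+ n) `^ (1 - s) = harmonic n.
Proof.
rewrite /critical_length -powRrM mulNr mulVf ?gt_eqF// powR_inv1 ?ltW//.
by rewrite invfM mulrAC mulVf ?mul1r// gt_eqF// powR_gt0// exprn_gt0.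
Qed.

End critical_series.

(** * Elementary inequalities and second-order expansions *)

Section elementary_bounds.
Context {R : realType}.
Implicit Types a b : R.

Lemma sin_mvt b : exists2 c, `|c| <= `|b| & sin b = cos c * b.
Proof.
wlog b0 : b / 0 <= b.
  move=> hw; have [/hw//|/ltW b0] := leP 0 b.
  have [c cb sE] := hw (- b) ltac:(by rewrite oppr_ge0).
  exists c; first by rewrite normrN in cb.
  by move: sE; rewrite sinN mulrN => /oppr_inj.
have [c] := @MVT_segment R sin cos 0 b b0
  (fun x _ => is_derive_sin x)
  (continuous_subspaceT (@continuous_sin R)).
rewrite in_itv/= => /andP[c0 cb]; rewrite sin0 !subr0 => ->.
by exists c => //; rewrite !ger0_norm.
Qed.

Lemma sin_norm_le b : `|sin b| <= `|b|.
Proof.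
by have [c _ ->] := sin_mvt b; rewrite normrM ler_piMl// ler_norml cos_geN1 cos_le1.
Qed.

Lemma one_sub_cos_le b : 1 - cos b <= b ^+ 2 / 2.
Proof.
have -> : b = (b / 2) *+ 2 by rewrite mulr2n; lra.
rewrite mulr2n cosD -!expr2.
have : sin (b / 2) ^+ 2 <= (b / 2) ^+ 2.
  by rewrite -[leLHS]real_normK ?num_real// -[leRHS]real_normK ?num_real// lerXn2r ?nnegrE// sin_norm_le.
have := cos2Dsin2 (b / 2).
set c := cos _; set d := sin _; lra.
Qed.

Lemma sin_sub_le b : `|b| <= 1 -> `|sin b - b| <= b ^+ 2.
Proof.
move=> b1; have [c cb ->] := sin_mvt b.
rewrite -[X in _ * _ - X]mul1r -mulrBl normrM distrC (@ger0_norm _ (1 - _)) ?subr_ge0 ?cos_le1//.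
rewrite -[leRHS]real_normK ?num_real// expr2 ler_wpM2r//.
apply: (le_trans (one_sub_cos_le c)).
have c0 := normr_ge0 c; rewrite -[X in X / 2]real_normK ?num_real//.
by set x := `|c| in cb c0 *; set y := `|b| in cb b1 *; nra.
Qed.

(** The upper bound comes from exp(a) (1 - a) <= exp(a) exp(-a) = 1. *)
Lemma expR_sub1D_le a : `|a| <= 1 / 2 -> 0 <= expR a - 1 - a <= 2 * a ^+ 2.
Proof.
rewrite ler_norml => /andP[a1 a2].
have e0 := expR_gt0 a; have := expR_ge1Dx a; have := expR_ge1Dx (- a).
have := expRxMexpNx_1 a.
move: (expR a) (expR (- a)) e0 => x y x0 xy h1 h2; apply/andP; split; first lra.
have : x * (1 - a) <= 1 by rewrite -[leRHS]xy ler_pM2l//; lra.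
nra.
Qed.

End elementary_bounds.

Section complex_modulus.
Context {R : realType}.
Local Notation normc := (@Normc.normc R).
Implicit Types z w : cplx R.

Lemma complex_normE z : `|z| = (normc z)%:C%C.
Proof. by rewrite normc_def; case: z. Qed.

Lemma normc_ge0 z : 0 <= normc z.
Proof. by case: z => a b; exact: sqrtr_ge0. Qed.

Lemma Re_norm z : complex.Re `|z| = normc z.
Proof. by rewrite complex_normE. Qed.

Lemma normc_sqr z : normc z ^+ 2 = complex.Re z ^+ 2 + complex.Im z ^+ 2.
Proof. by case: z => a b; rewrite sqr_sqrtr// addr_ge0 ?sqr_ge0. Qed.

Lemma normc_Re_le z : `|complex.Re z| <= normc z.
Proof.
rewrite -(@ler_pXn2r _ 2) ?nnegrE ?normc_ge0// normc_sqr real_normK ?num_real//.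
by rewrite lerDl sqr_ge0.
Qed.

Lemma normc_Im_le z : `|complex.Im z| <= normc z.
Proof.
rewrite -(@ler_pXn2r _ 2) ?nnegrE ?normc_ge0// normc_sqr real_normK ?num_real//.
by rewrite lerDr sqr_ge0.
Qed.

Lemma normc_le_ReIm z : normc z <= `|complex.Re z| + `|complex.Im z|.
Proof.
rewrite -(@ler_pXn2r _ 2) ?nnegrE ?normc_ge0 ?addr_ge0// normc_sqr sqrrD.
by rewrite !real_normK ?num_real// addrAC lerDl mulrn_wge0 ?mulr_ge0.
Qed.

Lemma normc_real (x : R) : normc x%:C%C = `|x|.
Proof. by rewrite /Normc.normc /= expr0n addr0 sqrtr_sqr. Qed.

Lemma normcX z n : normc (z ^+ n) = normc z ^+ n.
Proof.
elim: n => [|n IH]; first by rewrite !expr0 Normc.normc1.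
by rewrite !exprS Normc.normcM IH.
Qed.

Lemma normc_circle (xi : circle R) : normc (circle_val xi) = 1.
Proof.
case: xi => z zP; have := set_mem zP.
by rewrite /unit_circle /= complex_normE => -[].
Qed.

Lemma normc_subr_ge z w : normc z - normc w <= normc (z - w).
Proof. by rewrite lerBlDr -{1}(subrK w z) le_normcD. Qed.

Lemma normc_gt0_neq0 z : 0 < normc z -> z != 0.
Proof. by apply: contraTneq => ->; rewrite Normc.normc0 ltxx. Qed.

End complex_modulus.

Section quadratic_expansion.
Context {R : realType}.
Local Notation normc := (@Normc.normc R).
Implicit Types (f : cplx R -> cplx R) (z h D : cplx R).

(** Complex differentiability with a quadratic remainder.  The Herglotz integral
    satisfies it, and in this form the chain rule for the exponential is a
    single inequality between moduli. *)
Definition quad_deriv f z D := exists C delta : R, [/\ 0 < delta, 0 <= C &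
  forall h, normc h < delta -> normc (f (z + h) - f z - h * D) <= C * normc h ^+ 2].

Lemma quad_deriv_derive1 f z D : quad_deriv f z D -> derive1 f z = D.
Proof.
move=> [C [delta [delta0 C0 fD]]].
rewrite /derive1; apply: cvg_lim; first exact: norm_hausdorff.
apply/cvgrPdist_lt => -[e e'] /=; rewrite ltcE /= => /andP[/eqP -> {e'} e0].
pose d := Num.min delta (e / (C + 1)).
have d0 : 0 < d by rewrite lt_min delta0 divr_gt0// ltr_wpDl.
have near_neq : \forall h \near (0 : cplx R)^', h != 0 by exact: nbhs_dnbhs_neq.
have near_lt : \forall h \near (0 : cplx R)^', `|h| < (d%:C)%C.
  by apply: dnbhs0_lt; rewrite ltcR.
apply: filterS2 near_neq near_lt => h h0; rewrite complex_normE ltcR => hd.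
have nh0 : 0 < normc h.
  by rewrite lt_neqAle normc_ge0 andbT eq_sym; apply: contra h0 => /eqP/Normc.eq0_normc ->.
move: hd; rewrite lt_min => /andP[/fD hh he].
rewrite distrC complex_normE ltcR.
have -> : h^-1 *: (f (h + z) - f z) - D = h^-1 * (f (z + h) - f z - h * D).
  by rewrite [h + z]addrC mulrBr mulKf.
rewrite Normc.normcM Normc.normcV mulrC ltr_pdivrMr//.
apply: (le_lt_trans hh); rewrite expr2 mulrA ltr_pM2r//.
move: he; rewrite ltr_pdivlMr ?ltr_wpDl//; nra.
Qed.

Lemma cexpD z w : cexp (z + w) = cexp z * cexp w :> cplx R.
Proof.
case: z w => a b [c d]; rewrite /cexp /= expRD cosD sinD.
apply/eqP; rewrite eq_complex /=; apply/andP; split; apply/eqP; ring.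
Qed.

Lemma normc_cexp z : normc (cexp z) = expR (complex.Re z).
Proof.
rewrite /cexp Normc.normcM normc_real /= cos2Dsin2 sqrtr1 mulr1.
by rewrite ger0_norm ?expR_ge0.
Qed.

Lemma cexp_sub1D_le h : normc h <= 1 / 2 -> normc (cexp h - 1 - h) <= 4 * normc h ^+ 2.
Proof.
move=> h2; have ha := le_trans (normc_Re_le h) h2; have hb := le_trans (normc_Im_le h) h2.
rewrite normc_sqr; apply: le_trans (normc_le_ReIm _) _.
have -> : complex.Re (cexp h - 1 - h) =
    expR (complex.Re h) * cos (complex.Im h) - 1 - complex.Re h.
  by case: (h) => a b /=; rewrite mul0r subr0.
have -> : complex.Im (cexp h - 1 - h) =
    expR (complex.Re h) * sin (complex.Im h) - complex.Im h.
  by case: (h) => a b /=; rewrite mul0r addr0 oppr0 addr0.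
move: (complex.Re h) (complex.Im h) ha hb => a b ha hb {h h2}.
have /andP[e1 e2] := expR_sub1D_le ha.
have hb1 : `|b| <= 1 by lra.
have c1 := one_sub_cos_le b; have c2 := cos_le1 b.
have s1 := sin_sub_le hb1; have s2 := sin_norm_le b.
have e3 : 0 < expR a <= 2.
  rewrite expR_gt0/=; have := expR_ge1Dx (- a); have := expRxMexpNx_1 a.
  have := expR_gt0 a; move: ha; rewrite ler_norml; nra.
have re : `|expR a * cos b - 1 - a| <= 2 * a ^+ 2 + b ^+ 2.
  by rewrite ler_norml; apply/andP; split; nra.
have im : `|expR a * sin b - b| <= 2 * a ^+ 2 + 3 * b ^+ 2.
  have -> : expR a * sin b - b = (expR a - 1) * sin b + (sin b - b) by ring.
  apply: le_trans (ler_normD _ _) _; rewrite normrM.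
  have e4 : `|expR a - 1| <= 2 * `|a|.
    have -> : expR a - 1 = (expR a - 1 - a) + a by ring.
    apply: le_trans (ler_normD _ _) _; rewrite (ger0_norm e1).
    have : a ^+ 2 = `|a| ^+ 2 by rewrite real_normK ?num_real.
    have : `|a| ^+ 2 <= 1 / 2 * `|a| by rewrite expr2 ler_wpM2r.
    lra.
  have : `|expR a - 1| * `|sin b| <= (2 * `|a|) * `|b| by apply: ler_pM.
  have : `|a| ^+ 2 = a ^+ 2 by rewrite real_normK ?num_real.
  have : `|b| ^+ 2 = b ^+ 2 by rewrite real_normK ?num_real.
  have : 0 <= `|a| ^+ 2 - 2 * (`|a| * `|b|) + `|b| ^+ 2.
    by have := sqr_ge0 (`|a| - `|b|); rewrite sqrrB mulr_natl.
  rewrite -mulrA; have := sqr_ge0 a; lra.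
apply: le_trans (lerD re im) _; lra.
Qed.

Lemma quad_deriv_cexp f z D : quad_deriv f z D ->
  quad_deriv (fun z => cexp (f z)) z (cexp (f z) * D).
Proof.
move=> [C [delta [delta0 C0 fD]]].
pose L := normc D + C * 1.
have L0 : 0 <= L by rewrite addr_ge0 ?normc_ge0 ?mulr_ge0.
exists (normc (cexp (f z)) * (4 * L ^+ 2 + C)), (Num.min delta (Num.min 1 (1 / (2 * (L + 1))))).
split.
- by rewrite !lt_min delta0 ltr01 divr_gt0 ?mulr_gt0 ?ltr_wpDl.
- by rewrite mulr_ge0 ?normc_ge0 ?addr_ge0 ?mulr_ge0 ?sqr_ge0.
move=> h; rewrite !lt_min => /and3P[h1 h2 h3]; have {}fD := fD _ h1.
have h0 := normc_ge0 h.
pose w := f (z + h) - f z.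
have wL : normc w <= L * normc h.
  have -> : w = (w - h * D) + h * D by rewrite subrK.
  apply: le_trans (le_normcD _ _) _; rewrite Normc.normcM /L mulr1.
  have : C * normc h ^+ 2 <= C * normc h by rewrite ler_wpM2l// expr2 ler_piMl// ltW.
  by move: fD; rewrite -/w; lra.
have w2 : normc w <= 1 / 2.
  apply: (le_trans wL); rewrite ltr_pdivlMr ?mulr_gt0 ?ltr_wpDl// in h3; nra.
have -> : cexp (f (z + h)) - cexp (f z) - h * (cexp (f z) * D) =
    cexp (f z) * ((cexp w - 1 - w) + (w - h * D)).
  have -> : f (z + h) = f z + w by rewrite /w addrCA subrr addr0.
  by rewrite cexpD; ring.
rewrite Normc.normcM -mulrA ler_wpM2l ?normc_ge0//.
apply: le_trans (le_normcD _ _) _; rewrite mulrDl lerD//.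
apply: le_trans (cexp_sub1D_le w2) _.
rewrite -mulrA ler_wpM2l// -exprMn lerXn2r ?nnegrE ?normc_ge0 ?mulr_ge0//.
Qed.

End quadratic_expansion.

(** * Integrals of bounded continuous functions on the circle *)

Section circle_integral.
Context {R : realType}.
Local Notation normc := (@Normc.normc R).
Local Notation Re := (@complex.Re R).
Local Notation Im := (@complex.Im R).
Implicit Types (f g : circle R -> cplx R).

Lemma continuous_measurable_circle (g : circle R -> R) : continuous g ->
  measurable_fun setT g.
Proof.
move=> /continuousP cg; apply: (measurability _ (RGenOpens.measurableE R)).
move=> _ [_ [a [b ->] <-]]; rewrite setTI; apply: open_measurable_circle.
exact/cg/interval_open.
Qed.

Lemma continuous_lipschitz1 (phi : cplx R -> R) :
  (forall z w, `|phi z - phi w| <= normc (z - w)) -> continuous phi.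
Proof.
move=> lip z; apply/(@cvgrPdist_lt _ _ _ (nbhs z) (nbhs_filter z)) => e e0.
have H : \forall w \near z, `|z - w| < (e%:C)%C.
  by apply/nbhs_normP; exists (e%:C)%C; [rewrite /= ltcR|move=> w].
apply: filterS H => w; rewrite complex_normE ltcR; apply: le_lt_trans.
exact: lip.
Qed.

Lemma continuous_Re : continuous (Re : cplx R -> R).
Proof.
apply: continuous_lipschitz1 => z w; apply: le_trans (normc_Re_le _).
by case: z w => a b [c d].
Qed.

Lemma continuous_Im : continuous (Im : cplx R -> R).
Proof.
apply: continuous_lipschitz1 => z w; apply: le_trans (normc_Im_le _).
by case: z w => a b [c d].
Qed.

Lemma continuous_normc : continuous (normc : cplx R -> R).
Proof.
apply: continuous_lipschitz1 => z w; rewrite ler_norml normc_subr_ge andbT.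
by rewrite lerNl opprB -(normcN (z - w)) opprB normc_subr_ge.
Qed.

(** A class of functions that are integrable for every finite measure on the
    circle, closed under sums and products, and containing the kernels used
    below. *)
Definition bounded_continuous f :=
  continuous f /\ exists M : R, forall xi, normc (f xi) <= M.

Lemma bounded_continuous_cst z : bounded_continuous (fun=> z).
Proof. by split; [exact: cst_continuous|exists (normc z)]. Qed.

Lemma bounded_continuous_val : bounded_continuous (@circle_val R).
Proof.
split; first exact: initial_continuous.
by exists 1 => xi; rewrite normc_circle.
Qed.

Lemma bounded_continuousD f g : bounded_continuous f -> bounded_continuous g ->
  bounded_continuous (fun xi => f xi + g xi).
Proof.
move=> [cf [M fM]] [cg [N gN]]; split; first by move=> x; exact: (cvgD (cf x) (cg x)).
exists (M + N) => xi; exact: le_trans (le_normcD _ _) (lerD (fM _) (gN _)).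
Qed.

Lemma bounded_continuousM f g : bounded_continuous f -> bounded_continuous g ->
  bounded_continuous (fun xi => f xi * g xi).
Proof.
move=> [cf [M fM]] [cg [N gN]]; split; first by move=> x; exact: (cvgM (cf x) (cg x)).
exists (M * N) => xi; rewrite Normc.normcM.
exact: (ler_pM (normc_ge0 _) (normc_ge0 _) (fM _) (gN _)).
Qed.

Lemma normc_circle_sub_ge (xi : circle R) z : 1 - normc z <= normc (circle_val xi - z).
Proof. by rewrite -(normc_circle xi) normc_subr_ge. Qed.

Lemma bounded_continuous_inv z : normc z < 1 ->
  bounded_continuous (fun xi => (circle_val xi - z)^-1).
Proof.
move=> z1; have d0 : 0 < 1 - normc z by rewrite subr_gt0.
split.
  move=> x; have ne : circle_val x - z != 0.
    apply: normc_gt0_neq0; exact: lt_le_trans d0 (normc_circle_sub_ge _ _).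
  have cs : {for x, continuous (fun xi : circle R => circle_val xi - z)}.
    exact: (bounded_continuousD bounded_continuous_val (bounded_continuous_cst (- z))).1.
  exact: (@continuousV (cplx R) (circle R) _ x ne cs).
exists (1 - normc z)^-1 => xi; rewrite Normc.normcV lef_pV2 ?posrE//.
  exact: normc_circle_sub_ge.
exact: lt_le_trans d0 (normc_circle_sub_ge _ _).
Qed.

Context (nu : {finite_measure set (circle R) -> \bar R}).

Let nu_finite : (nu setT < +oo)%E.
Proof. by rewrite ltey_eq fin_num_measure. Qed.

Let bounded_real_integrable (g : circle R -> R) M : continuous g ->
  (forall xi, `|g xi| <= M) -> nu.-integrable setT (EFin \o g).
Proof.
move=> cg gM; apply: measurable_bounded_integrable => //.
  exact: continuous_measurable_circle.
exists M; split; first exact: num_real.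
by move=> x Mx xi _ /=; apply: le_trans (gM xi) (ltW Mx).
Qed.

Lemma bounded_continuous_integrable f : bounded_continuous f ->
  nu.-integrable setT (EFin \o (Re \o f)) /\ nu.-integrable setT (EFin \o (Im \o f)).
Proof.
move=> [cf [M fM]]; split.
  apply: (bounded_real_integrable (M := M)) => [x|xi].
    by apply: continuous_comp; [exact: cf|exact: continuous_Re].
  exact: le_trans (normc_Re_le _) (fM _).
apply: (bounded_real_integrable (M := M)) => [x|xi].
  by apply: continuous_comp; [exact: cf|exact: continuous_Im].
exact: le_trans (normc_Im_le _) (fM _).
Qed.

Lemma cintegralD f g : bounded_continuous f -> bounded_continuous g ->
  cintegral nu (fun xi => f xi + g xi) = cintegral nu f + cintegral nu g.
Proof.
move=> /bounded_continuous_integrable[fR fI] /bounded_continuous_integrable[gR gI].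
have ReD (z w : cplx R) : Re (z + w) = Re z + Re w by case: z w => ? ? [].
have ImD (z w : cplx R) : Im (z + w) = Im z + Im w by case: (z) w => ? ? [].
rewrite /cintegral; apply/eqP; rewrite eq_complex /=; apply/andP; split; apply/eqP.
  rewrite -RintegralD//; apply: eq_Rintegral => xi _; exact: ReD.
rewrite -RintegralD//; apply: eq_Rintegral => xi _; exact: ImD.
Qed.

Lemma cintegralZ (z : cplx R) f : bounded_continuous f ->
  cintegral nu (fun xi => z * f xi) = z * cintegral nu f.
Proof.
move=> /bounded_continuous_integrable[fR fI].
have intZ (k : R) (g : circle R -> R) : nu.-integrable setT (EFin \o g) ->
    nu.-integrable setT (EFin \o (fun x => k * g x)).
  by move=> ig; apply: (integrableZl measurableT k ig).
have ReM (w : cplx R) : Re (z * w) = Re z * Re w - Im z * Im w.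
  by case: (z) w => ? ? [].
have ImM (w : cplx R) : Im (z * w) = Re z * Im w + Im z * Re w.
  by case: (z) w => ? ? [].
rewrite /cintegral; apply/eqP; rewrite eq_complex ReM ImM /=; apply/andP; split; apply/eqP.
  rewrite -!RintegralZl// -RintegralB//; last 2 first.
  - exact: intZ.
  - exact: intZ.
  by apply: eq_Rintegral => xi _; exact: ReM.
rewrite -!RintegralZl// -RintegralD//; last 2 first.
- exact: intZ.
- exact: intZ.
by apply: eq_Rintegral => xi _; exact: ImM.
Qed.

(** The factor 2 is the price of estimating the real and the imaginary parts
    separately. *)
Lemma cintegral_norm_le f M : bounded_continuous f ->
  (forall xi, normc (f xi) <= M) ->
  normc (cintegral nu f) <= 2 * M * fine (nu setT).
Proof.
move=> /bounded_continuous_integrable[fR fI] fM.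
have icst : nu.-integrable setT (EFin \o (fun=> M)).
  by apply: (bounded_real_integrable (M := `|M|)) => //; exact: cst_continuous.
have bound (g : circle R -> R) : nu.-integrable setT (EFin \o g) ->
    (forall xi, `|g xi| <= M) -> `|\int[nu]_xi g xi| <= M * fine (nu setT).
  move=> ig gM; apply: le_trans (le_normr_Rintegral _ _) _ => //.
  rewrite -Rintegral_cst//; apply: le_Rintegral => //.
  exact: (integrable_norm ig).
apply: le_trans (normc_le_ReIm _) _; rewrite -mulrA mulr_natl mulr2n lerD//=.
  by apply: bound => // xi; apply: le_trans (normc_Re_le _) (fM _).
by apply: bound => // xi; apply: le_trans (normc_Im_le _) (fM _).
Qed.

End circle_integral.

(** * The derivative of a singular inner function *)

Section singular_inner_derivative.
Context {R : realType} (nu : {finite_measure set (circle R) -> \bar R}).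
Local Notation normc := (@Normc.normc R).
Local Notation Re := (@complex.Re R).
Local Notation Im := (@complex.Im R).

Definition herglotz_kernel (z : cplx R) (xi : circle R) : cplx R :=
  (circle_val xi + z) / (circle_val xi - z).

(** The derivative of [herglotz_kernel] with respect to z, written
    with an inverse so that it is visibly a product of bounded continuous
    functions. *)
Definition herglotz_kernel_deriv (z : cplx R) (xi : circle R) : cplx R :=
  2 * (circle_val xi * (circle_val xi - z)^-1 ^+ 2).

Lemma bounded_continuous_herglotz z : normc z < 1 ->
  bounded_continuous (herglotz_kernel z).
Proof.
move=> z1; apply: bounded_continuousM; last exact: bounded_continuous_inv.
by apply: bounded_continuousD; [exact: bounded_continuous_val|exact: bounded_continuous_cst].
Qed.

Lemma bounded_continuous_herglotz_deriv z : normc z < 1 ->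
  bounded_continuous (herglotz_kernel_deriv z).
Proof.
move=> z1; apply: bounded_continuousM; first exact: bounded_continuous_cst.
apply: bounded_continuousM; first exact: bounded_continuous_val.
by apply: bounded_continuousM; exact: bounded_continuous_inv.
Qed.

Lemma circle_sub_neq0 (xi : circle R) (z : cplx R) : normc z < 1 -> circle_val xi - z != 0.
Proof.
move=> z1; apply: normc_gt0_neq0; apply: lt_le_trans (normc_circle_sub_ge _ _).
by rewrite subr_gt0.
Qed.

(** Differentiation under the integral sign is exact here: the second-order
    remainder of the kernel is 2 zeta h^2 / ((zeta - z - h) (zeta - z)^2), and
    zeta - z and zeta - z - h are at least d and d/2 in modulus when |h| < d/2,
    where d = 1 - |z|. *)
Lemma quad_deriv_herglotz z : normc z < 1 ->
  quad_deriv (fun z => cintegral nu (herglotz_kernel z)) z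
    (cintegral nu (herglotz_kernel_deriv z)).
Proof.
move=> z1; pose d := 1 - normc z; have d0 : 0 < d by rewrite subr_gt0.
exists (2 * (4 / d ^+ 3) * fine (nu setT)), (d / 2); split.
- by rewrite divr_gt0.
- by rewrite !mulr_ge0 ?invr_ge0 ?exprn_ge0 ?fine_ge0 ?(ltW d0).
move=> h hd.
have zh1 : normc (z + h) < 1.
  by apply: le_lt_trans (le_normcD _ _) _; move: hd; rewrite /d; lra.
have bz := bounded_continuous_herglotz z1.
have bzh := bounded_continuous_herglotz zh1.
have bz' := bounded_continuous_herglotz_deriv z1.
have bc c f : bounded_continuous f -> bounded_continuous (fun xi : circle R => c * f xi).
  by apply: bounded_continuousM; exact: bounded_continuous_cst.
have -> : cintegral nu (herglotz_kernel (z + h)) - cintegral nu (herglotz_kernel z) -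
    h * cintegral nu (herglotz_kernel_deriv z) =
    cintegral nu (fun xi => herglotz_kernel (z + h) xi +
      ((-1) * herglotz_kernel z xi + (- h) * herglotz_kernel_deriv z xi)).
  rewrite (cintegralD _ bzh (bounded_continuousD (bc _ _ bz) (bc _ _ bz'))).
  rewrite (cintegralD _ (bc _ _ bz) (bc _ _ bz')).
  by rewrite (cintegralZ _ (-1) bz) (cintegralZ _ (- h) bz'); ring.
have bsum := bounded_continuousD bzh (bounded_continuousD (bc (-1) _ bz) (bc (- h) _ bz')).
set F := (fun xi => _) in bsum *.
have -> : 2 * (4 / d ^+ 3) * fine (nu setT) * normc h ^+ 2 =
    2 * (4 / d ^+ 3 * normc h ^+ 2) * fine (nu setT) by ring.
apply: cintegral_norm_le bsum _; rewrite /F.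
move=> xi; rewrite /herglotz_kernel /herglotz_kernel_deriv.
have n1 := circle_sub_neq0 xi z1; have n2 := circle_sub_neq0 xi zh1.
have -> : (circle_val xi + (z + h)) / (circle_val xi - (z + h)) +
   (-1 * ((circle_val xi + z) / (circle_val xi - z)) +
    - h * (2 * (circle_val xi * (circle_val xi - z)^-1 ^+ 2))) =
   2 * circle_val xi * h ^+ 2 * ((circle_val xi - (z + h))^-1 * (circle_val xi - z)^-1 ^+ 2).
  by field; rewrite n1.
have d1 := normc_circle_sub_ge xi z; have d2 := normc_circle_sub_ge xi (z + h).
rewrite Normc.normcM (Normc.normcM (2 * _)) (Normc.normcM 2) normcX normc_circle mulr1.
rewrite (Normc.normcM _ (_ ^+ _)) normcX !Normc.normcV.
have -> : normc 2 = 2 by rewrite (_ : 2 = (2%:R%:C)%C) ?normc_real ?ger0_norm// rmorph_nat.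
rewrite mulrAC ler_wpM2r ?exprn_ge0 ?normc_ge0//.
have -> : 4 / d ^+ 3 = 2 * ((d / 2)^-1 * d^-1 ^+ 2) by field; rewrite gt_eqF.
rewrite ler_pM2l// ler_pM ?invr_ge0 ?exprn_ge0 ?invr_ge0 ?normc_ge0//.
  rewrite lef_pV2 ?posrE ?divr_gt0//.
    by have := le_normcD z h; move: d2 hd; rewrite /d; lra.
  by have := le_normcD z h; move: d2 hd; rewrite /d; lra.
rewrite lerXn2r ?nnegrE ?invr_ge0 ?normc_ge0 ?(ltW d0)// lef_pV2 ?posrE//.
by rewrite /d in d0 *; lra.
Qed.

Lemma singular_inner_derive1 z : normc z < 1 ->
  derive1 (singular_inner nu) z =
  - (singular_inner nu z * cintegral nu (herglotz_kernel_deriv z)).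
Proof.
move=> z1; rewrite -mulrN; apply: quad_deriv_derive1.
apply: (@quad_deriv_cexp R (fun z => - cintegral nu (herglotz_kernel z))).
have [C [delta [delta0 C0 H]]] := quad_deriv_herglotz z1.
exists C, delta; split => // h /H.
by rewrite -normcN; congr (normc _ <= _); ring.
Qed.

Lemma Re_div (u v : cplx R) : Re (u / v) = (Re u * Re v + Im u * Im v) / normc v ^+ 2.
Proof. by rewrite normc_sqr; case: u v => a b [c d] /=; ring. Qed.

(** Half of the squared distance |zeta - xi|^2. *)
Definition chord (zeta xi : circle R) : R :=
  1 - (Re (circle_val zeta) * Re (circle_val xi) + Im (circle_val zeta) * Im (circle_val xi)).

Lemma circle_sqr (xi : circle R) : Re (circle_val xi) ^+ 2 + Im (circle_val xi) ^+ 2 = 1.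
Proof. by rewrite -normc_sqr normc_circle expr1n. Qed.

(** Expansion of |zeta - r xi|^2 with |zeta| = |xi| = 1; the two lemmas on
    kernels that follow express them in terms of [chord] only. *)
Lemma normc_radial_sub (zeta xi : circle R) (r : R) :
  normc (circle_val zeta - (r%:C)%C * circle_val xi) ^+ 2 =
  (1 - r) ^+ 2 + 2 * r * chord zeta xi.
Proof.
rewrite normc_sqr /chord; have := circle_sqr zeta; have := circle_sqr xi.
case: (circle_val zeta) (circle_val xi) => a b [c d] /= h1 h2.
rewrite !mul0r !addr0 !subr0.
have -> : (a - r * c) ^+ 2 + (b - r * d) ^+ 2 =
  (a ^+ 2 + b ^+ 2) + r ^+ 2 * (c ^+ 2 + d ^+ 2) - 2 * r * (a * c + b * d) by ring.
by rewrite h1 h2; ring.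
Qed.

Lemma Re_herglotz_kernel (zeta xi : circle R) (r : R) :
  Re (herglotz_kernel ((r%:C)%C * circle_val xi) zeta) =
  (1 - r ^+ 2) / ((1 - r) ^+ 2 + 2 * r * chord zeta xi).
Proof.
rewrite Re_div normc_radial_sub; congr (_ / _).
have := circle_sqr zeta; have := circle_sqr xi.
case: (circle_val zeta) (circle_val xi) => a b [c d] /= h1 h2.
rewrite !mul0r !addr0 !subr0.
have -> : (a + r * c) * (a - r * c) + (b + r * d) * (b - r * d) =
  (a ^+ 2 + b ^+ 2) - r ^+ 2 * (c ^+ 2 + d ^+ 2) by ring.
by rewrite h1 h2; ring.
Qed.

(** As zeta and xi have modulus 1, multiplying numerator and denominator by the
    conjugate of (zeta - r xi)^2 leaves the numerator
      2 (xi/zeta - 2 r + r^2 zeta/xi)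
    over |zeta - r xi|^4.  At r = 1 its real part is - 1 / [chord], so that the
    factor xi aligns the contributions of all zeta. *)
Lemma Re_herglotz_kernel_deriv (zeta xi : circle R) (r : R) :
  - Re (circle_val xi * herglotz_kernel_deriv ((r%:C)%C * circle_val xi) zeta) =
  2 * ((1 + r ^+ 2) * chord zeta xi - (1 - r) ^+ 2) /
    ((1 - r) ^+ 2 + 2 * r * chord zeta xi) ^+ 2.
Proof.
have -> : circle_val xi * herglotz_kernel_deriv ((r%:C)%C * circle_val xi) zeta =
    (2 * (circle_val xi * circle_val zeta)) /
    (circle_val zeta - (r%:C)%C * circle_val xi) ^+ 2.
  by rewrite /herglotz_kernel_deriv exprVn; ring.
rewrite Re_div normcX normc_radial_sub -mulNr; congr (_ / _).
rewrite /chord; have := circle_sqr zeta; have := circle_sqr xi.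
case: (circle_val zeta) (circle_val xi) => a b [c d] /= h1 h2.
rewrite !mul0r !addr0 !subr0.
transitivity (- (2 * ((a ^+ 2 + b ^+ 2 + r ^+ 2 * (c ^+ 2 + d ^+ 2)) * (a * c + b * d) -
    2 * r * (a ^+ 2 + b ^+ 2) * (c ^+ 2 + d ^+ 2)))); first by ring.
by rewrite h1 h2; ring.
Qed.

Lemma Rintegral_supported (E : set (circle R)) (g : circle R -> R) :
  measurable E -> nu (~` E) = 0%E -> nu.-integrable setT (EFin \o g) ->
  \int[nu]_xi g xi = \int[nu]_(xi in E) g xi.
Proof.
move=> mE nE ig; rewrite /Rintegral.
by rewrite (negligible_integral (measurableC mE) measurableT ig nE) setTD setCK.
Qed.

(** Lower bound at a point r xi facing the complement of E.  With
    a = 2 r [chord] and b = (1 - r)^2, the quantity in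
    [Re_herglotz_kernel_deriv] is at least 2 (a - b) / (a + b)^2, and the first
    closeness condition on r gives b <= a / 2.  The second one makes the
    Poisson kernel at most 1 on E, whence |S_nu| >= exp(-nu(T)). *)
Lemma singular_inner_derive1_ge (E A : set (circle R)) (xi : circle R) (r kappa X : R) :
  measurable E -> measurable A -> A `<=` E -> nu (~` E) = 0%E ->
  0 < r < 1 -> 0 < kappa ->
  (forall zeta, E zeta -> kappa <= chord zeta xi) ->
  (forall zeta, A zeta -> chord zeta xi <= X) ->
  (1 - r) ^+ 2 <= r * kappa -> 1 - r ^+ 2 <= 2 * r * kappa -> 0 < X ->
  expR (- fine (nu setT)) * (2 / (9 * X) * fine (nu A)) <=
  normc (derive1 (singular_inner nu) ((r%:C)%C * circle_val xi)).
Proof.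
move=> mE mA AE nE /andP[r0 r1] k0 Ek AX rk1 rk2 X0.
set z := (r%:C)%C * circle_val xi.
have z1 : normc z < 1.
  by rewrite Normc.normcM normc_real normc_circle mulr1 gtr0_norm.
have nuT : (nu setT < +oo)%E by rewrite ltey_eq fin_num_measure.
have icst (D : set (circle R)) c : measurable D -> nu.-integrable D (EFin \o (fun=> c)).
  move=> mD; apply: (integrableS measurableT) => //.
  exact: (bounded_continuous_integrable nu (bounded_continuous_cst (c%:C)%C)).1.
rewrite (singular_inner_derive1 z1) normcN Normc.normcM.
apply: ler_pM; rewrite ?expR_ge0 ?mulr_ge0 ?invr_ge0 ?fine_ge0 ?mulr_ge0 ?(ltW X0)//.
  (* |S_nu(z)| is the exponential of minus the Poisson integral. *)
  rewrite normc_cexp ler_expR.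
  have -> : Re (- cintegral nu (herglotz_kernel z)) =
      - \int[nu]_zeta Re (herglotz_kernel z zeta) by [].
  have ik := (bounded_continuous_integrable nu (bounded_continuous_herglotz z1)).1.
  rewrite lerN2 (Rintegral_supported mE nE ik).
  apply: (@le_trans _ _ (\int[nu]_(zeta in E) 1)).
    apply: le_Rintegral => //; [exact: (integrableS measurableT mE _ ik)|exact: icst|].
    move=> {nE} zeta /Ek h; rewrite [X in X <= _]Re_herglotz_kernel.
    have rk : r * kappa <= r * chord zeta xi by rewrite ler_wpM2l// ltW.
    have rk0 : 0 < r * kappa by rewrite mulr_gt0.
    have := sqr_ge0 (1 - r); rewrite ler_pdivrMr; lra.
  rewrite Rintegral_cst// mul1r fine_le ?fin_num_measure//.
  by apply: le_measure; rewrite ?inE.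
have bk' := bounded_continuous_herglotz_deriv z1.
have bxik' := bounded_continuousM (bounded_continuous_cst (circle_val xi)) bk'.
have -> : normc (cintegral nu (herglotz_kernel_deriv z)) =
    normc (cintegral nu (fun zeta => circle_val xi * herglotz_kernel_deriv z zeta)).
  by rewrite cintegralZ// Normc.normcM normc_circle mul1r.
apply: le_trans (normc_Re_le _); rewrite -normrN; apply: le_trans (ler_norm _).
have ik := (bounded_continuous_integrable nu bxik').1.
rewrite /cintegral /= -[leRHS]mulN1r -RintegralZl//.
have iNk : nu.-integrable setT
    (EFin \o (fun zeta => -1 * Re (circle_val xi * herglotz_kernel_deriv z zeta))).
  exact: (integrableZl measurableT (-1) ik).
rewrite (Rintegral_supported mE nE iNk) -(setDUK AE).
have mEA : measurable (E `\` A) by exact: measurableD.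
rewrite Rintegral_setU//; last 2 first.
- by rewrite setDUK//; exact: (integrableS measurableT mE _ iNk).
- by rewrite disj_set2E setDIK.
have kernel_ge zeta : E zeta ->
    2 * (1 * (r * chord zeta xi)) / (3 * (r * chord zeta xi)) ^+ 2 <=
    -1 * Re (circle_val xi * herglotz_kernel_deriv z zeta).
  move=> {nE} /Ek h; rewrite mulN1r /z Re_herglotz_kernel_deriv.
  have rk : r * kappa <= r * chord zeta xi by rewrite ler_wpM2l// ltW.
  have rk0 : 0 < r * kappa by rewrite mulr_gt0.
  have sq := sqr_ge0 (1 - r).
  have chi0 : 0 <= chord zeta xi by exact: le_trans (ltW k0) h.
  apply: ler_pM.
  - by rewrite mul1r mulr_ge0// (le_trans (ltW rk0)).
  - by rewrite invr_ge0 sqr_ge0.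
  - have : 0 <= (1 - r) ^+ 2 * chord zeta xi by rewrite mulr_ge0.
    by rewrite ler_pM2l//; lra.
  - rewrite lef_pV2 ?posrE ?exprn_gt0//; [|lra|lra].
    by rewrite lerXn2r ?nnegrE; lra.
(* The part of the integral over A is kept, the rest is nonnegative. *)
rewrite -[leLHS]addr0; apply: lerD.
  rewrite -Rintegral_cst//; apply: le_Rintegral => //; [exact: icst|exact: (integrableS measurableT mA _ iNk)|].
  move=> zeta Az; apply: le_trans (kernel_ge _ (AE _ Az)).
  have chiX := AX _ Az; have chik := Ek _ (AE _ Az).
  have chi0 : 0 < chord zeta xi by exact: lt_le_trans chik.
  have -> : 2 * (1 * (r * chord zeta xi)) / (3 * (r * chord zeta xi)) ^+ 2 =
      2 / (9 * (r * chord zeta xi)) by field; rewrite !gt_eqF.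
  rewrite ler_pM2l// lef_pV2 ?posrE ?mulr_gt0// ler_pM2l//.
  by apply: le_trans chiX; rewrite ler_piMl ?ltW.
apply: Rintegral_ge0 => zeta [Ez _]; apply: le_trans (kernel_ge _ Ez).
have chi0 : 0 <= r * chord zeta xi by rewrite mulr_ge0 ?(ltW r0)// (le_trans (ltW k0))// Ek.
by rewrite mul1r divr_ge0 ?sqr_ge0// mulr_ge0.
Qed.

End singular_inner_derivative.

(** * Radial means and chords *)

Section hardy_integrals.
Context {R : realType}.
Local Notation normc := (@Normc.normc R).

(** Complex differentiability gives continuity on the circle of radius r, hence
    measurability. *)
Lemma holomorphic_radial_measurable (f : cplx R -> cplx R) (r p : R) :
  holomorphic_disk f -> 0 < r < 1 ->
  measurable_fun [set: circle R]
    (fun xi => ((complex.Re `|f ((r%:C)%C * circle_val xi)|) `^ p)%:E).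
Proof.
move=> hf /andP[r0 r1]; apply/measurable_EFinP.
apply: (@measurableT_comp _ _ _ _ _ _ (@powR R ^~ p)); first exact: measurable_powR.
rewrite (_ : (fun xi => _) = (fun xi => normc (f ((r%:C)%C * circle_val xi)))); last first.
  by apply/funext => xi; rewrite Re_norm.
apply: continuous_measurable_circle => xi.
have z1 : unit_disk ((r%:C)%C * circle_val xi).
  by rewrite /unit_disk /= complex_normE Normc.normcM normc_real normc_circle mulr1 gtr0_norm// ltcR.
have cf : {for (r%:C)%C * circle_val xi, continuous f}.
  by apply/differentiable_continuous; rewrite -derivable1_diffP; exact: hf.
have cr := (bounded_continuousM (bounded_continuous_cst (r%:C)%C) (@bounded_continuous_val R)).1 xi.
apply: continuous_comp; last exact: continuous_normc.
exact: (continuous_comp cr cf).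
Qed.

Lemma integral_ge_disjoint (d : measure_display) (T : measurableType d)
    (mu : {measure set T -> \bar R}) (I : eqType) (A : I -> set T) (s : seq I)
    (c : I -> R) (F : T -> \bar R) :
  measurable_fun setT F -> (forall x, (0 <= F x)%E) ->
  (forall i, measurable (A i)) -> uniq s -> trivIset [set` s] A ->
  (forall i, 0 <= c i) ->
  (forall i x, i \in s -> A i x -> ((c i)%:E <= F x)%E) ->
  (\sum_(i <- s) (c i)%:E * mu (A i) <= \int[mu]_x F x)%E.
Proof.
move=> mF F0 mA us tA c0 cF.
pose D := \big[setU/set0]_(i <- s) A i.
have mD : measurable D by apply: bigsetU_measurable => i _; exact: mA.
apply: (@le_trans _ _ (\int[mu]_(x in D) F x)%E); last first.
  by apply: ge0_subset_integral.
rewrite ge0_integral_bigsetU//; last first.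
  exact: measurable_funS mF.
rewrite big_seq [leRHS]big_seq; apply: lee_sum => i si.
rewrite -integral_cst//; apply: ge0_le_integral => //.
- by move=> x _; rewrite lee_fin.
- exact: measurable_funS mF.
- by move=> x Ax; exact: cF.
Qed.

Lemma chord_circle_param (x y : R) :
  chord (circle_param y) (circle_param x) = 1 - cos (2 * pi * (y - x)).
Proof. by rewrite mulrBr cosB. Qed.

Lemma chord_le (x y L : R) : `|y - x| <= L ->
  chord (circle_param y) (circle_param x) <= (2 * pi * L) ^+ 2 / 2.
Proof.
move=> h; rewrite chord_circle_param; apply: le_trans (one_sub_cos_le _) _.
have p0 := pi_gt0 R.
rewrite ler_pM2r// -[leLHS]real_normK ?num_real// lerXn2r ?nnegrE//.
  by rewrite mulr_ge0 ?mulr_ge0 ?(ltW p0)// (le_trans _ h).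
by rewrite normrM gtr0_norm ?mulr_gt0// ler_pM2l ?mulr_gt0.
Qed.

(** On the circle, x and y are at distance min(|y - x|, 1 - |y - x|), hence the
    bound on both sides. *)
Lemma chord_ge (x y d : R) : 0 <= d -> d <= `|y - x| <= 1 - d ->
  1 - cos (2 * pi * d) <= chord (circle_param y) (circle_param x).
Proof.
move=> d0 /andP[dt td]; rewrite chord_circle_param lerD2l lerN2.
have p0 := pi_gt0 R.
have -> : cos (2 * pi * (y - x)) = cos (2 * pi * `|y - x|).
  have [h|h] := leP 0 (y - x); first by rewrite ger0_norm.
  by rewrite ltr0_norm// mulrN cosN.
move: (`|y - x| : R) dt td => t dt td.
have cos_le (u v : R) : 0 <= u -> u <= v -> v <= 1 / 2 -> cos (2 * pi * v) <= cos (2 * pi * u).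
  have rng (w : R) : 0 <= w -> w <= 1 / 2 -> 2 * pi * w \in `[0, (pi : R)].
    move=> w0 w2; rewrite in_itv/= mulr_ge0 ?mulr_ge0 ?(ltW p0)//=.
    by rewrite mulrAC ler_piMl ?(ltW p0)//; lra.
  move=> u0 uv v2; have ru := rng u u0 (le_trans uv v2).
  have rv := rng v (le_trans u0 uv) v2; rewrite leNgt ltr_cos//.
  by rewrite -leNgt ler_pM2l ?mulr_gt0.
have [t2|t2] := leP t (1 / 2); first exact: cos_le.
have -> : cos (2 * pi * t) = cos (2 * pi * (1 - t)).
  rewrite -cosN -cosD2pi; congr cos; rewrite mulr2n; ring.
by apply: cos_le; lra.
Qed.

Lemma radius_near1 (kappa : R) : 0 < kappa -> exists r,
  [/\ 0 < r < 1, (1 - r) ^+ 2 <= r * kappa & 1 - r ^+ 2 <= 2 * r * kappa].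
Proof.
move=> k0; pose delta := Num.min (1 / 2) (kappa / 4).
have d1 : delta <= 1 / 2 by rewrite ge_min lexx.
have d2 : delta <= kappa / 4 by rewrite ge_min lexx orbT.
have d0 : 0 < delta by rewrite lt_min !divr_gt0.
exists (1 - delta); move: delta d0 d1 d2 => delta d0 d1 d2.
by split; nra.
Qed.

End hardy_integrals.

(** * Images of the uniform measure *)

Lemma le_geometric_le0 (R : realType) (a : \bar R) (c rho : R) : 0 <= rho < 1 ->
  (forall n, (a <= (c * rho ^+ n)%:E)%E) -> (a <= 0)%E.
Proof.
move=> /andP[rho0 rho1] h.
apply: (@cvge_to_ge _ \oo _ _ (fun n => (c * rho ^+ n)%:E) a 0%E); last by apply: nearW.
apply: cvg_EFin; first exact: nearW.
rewrite -(mulr0 c); apply: cvgMr; apply: cvg_expr.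
by rewrite ger0_norm.
Qed.

(** Named so as to carry the structure of a probability. *)
Definition unit_uniform (R : realType) : set (measurableTypeR R) -> \bar R :=
  mrestr (@lebesgue_measure R) (measurable_itv `[0, 1[).

HB.instance Definition _ (R : realType) :=
  Measure.on (@unit_uniform R).

Lemma unit_uniform_setT (R : realType) : @unit_uniform R setT = 1%E.
Proof.
by rewrite /unit_uniform /mrestr setTI lebesgue_measure_itv /= lte_fin ltr01 oppr0 adde0.
Qed.

HB.instance Definition _ (R : realType) :=
  Measure_isProbability.Build _ _ _ (@unit_uniform R) (unit_uniform_setT R).

Lemma image_probability (R : realType) (X : measurableTypeR R -> circle R) :
  measurable_fun setT X ->
  exists mu : probability (circle R) R, forall A,
    mu A = @lebesgue_measure R (X @^-1` A `&` `[0, 1[).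
Proof.
move=> mX; pose X' : {mfun measurableTypeR R >-> circle R} := mfun_Sub (mem_set mX).
by exists (distribution (@unit_uniform R) X').
Qed.

(** * The Cantor construction *)

Section cantor_intervals.
Context {R : realType} (ell : nat -> R).

(** The left end of the k-th interval of generation n, whose two children are
    flush with its ends and have the indices 2k and 2k+1.  The intervals of
    index at least 2^n lie outside [0, 1]; starting them at the even integers
    keeps the intervals of a generation disjoint and in order for all k, and
    makes [cantor_fun] monotone on the whole line. *)
Fixpoint cantor_left (n k : nat) : R :=
  if n is m.+1 then
    cantor_left m k./2 + (if odd k then ell m - ell m.+1 else 0)
  else k.*2%:R.

Definition in_cantor_itv n k (x : R) :=
  cantor_left n k <= x <= cantor_left n k + ell n.

Definition in_cantor_gap n k (x : R) :=
  cantor_left n k + ell n.+1 < x < cantor_left n k + (ell n - ell n.+1).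

(** For 0 <= x < 1, the first n binary digits of x read as an integer. *)
Definition dyadic_digits n (x : R) : nat := Num.truncn (2 ^+ n * x).

(** The map that reads the binary digits of x as left or right turns in the
    Cantor tree.  On [0, 1[ it is a right inverse of the Cantor staircase, so
    the image under it of the uniform measure is the Cantor measure. *)
Definition cantor_fun (x : R) : R :=
  sup (range (fun n => cantor_left n (dyadic_digits n x))).

Context (ell0 : ell 0%N = 1) (ell_gt0 : forall n, 0 < ell n)
  (ell_half : forall n, 2 * ell n.+1 < ell n).

Lemma cantor_itv_parent n k x :
  in_cantor_itv n.+1 k x -> in_cantor_itv n k./2 x.
Proof.
rewrite /in_cantor_itv /=; have := ell_half n; have := ell_gt0 n.+1.
by case: (odd k) => *; lra.
Qed.

Lemma cantor_itv_ancestor m n k x :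
  in_cantor_itv (m + n) k x -> in_cantor_itv n (k %/ 2 ^ m) x.
Proof.
elim: m k => [|m IH] k; first by rewrite divn1.
by rewrite addSn expnS divnMA divn2 => /cantor_itv_parent/IH.
Qed.

Lemma cantor_left_sep n k j : (k < j)%N ->
  cantor_left n k + ell n < cantor_left n j.
Proof.
elim: n k j => [|n IH] k j kj /=.
  by rewrite ell0 -(natrD _ _ 1) ltr_nat; lia.
have l1 := ell_gt0 n.+1; have l2 := ell_half n.
have [kj2|jk2] := ltnP k./2 j./2.
  have := IH _ _ kj2.
  by case: (odd k); case: (odd j) => ?; lra.
have kj2 : k./2 = j./2 by apply/eqP; rewrite eqn_leq jk2 half_leq// ltnW.
have [ok oj] : ~~ odd k /\ odd j.
  have := odd_double_half k; have := odd_double_half j.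
  by rewrite kj2; case: (odd k); case: (odd j) => /= *; split => //; lia.
by rewrite kj2 (negbTE ok) oj; lra.
Qed.

Lemma cantor_itv_uniq n k j x :
  in_cantor_itv n k x -> in_cantor_itv n j x -> k = j.
Proof.
move=> /andP[kx xk] /andP[jx xj]; case: (ltngtP k j) => // /(cantor_left_sep n) h.
- by have := le_lt_trans (le_trans jx xk) h; rewrite ltxx.
- by have := le_lt_trans (le_trans kx xj) h; rewrite ltxx.
Qed.

Lemma cantor_left_homo n : {homo cantor_left n : k j / (k <= j)%N >-> k <= j}.
Proof.
move=> k j; rewrite leq_eqVlt => /predU1P[->//|/(cantor_left_sep n)].
by have := ell_gt0 n; lra.
Qed.

Lemma cantor_left_in n k : in_cantor_itv n k (cantor_left n k).
Proof. by rewrite /in_cantor_itv lexx lerDl ltW. Qed.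

Lemma cantor_right_in n k : in_cantor_itv n k (cantor_left n k + ell n).
Proof. by rewrite /in_cantor_itv lexx lerDl ltW. Qed.

Lemma in_cantor_itv01 n k x : (k < 2 ^ n)%N -> in_cantor_itv n k x -> 0 <= x <= 1.
Proof.
move=> kn; rewrite -{1}[n]addn0 => /cantor_itv_ancestor.
by rewrite divn_small// /in_cantor_itv /= ell0 add0r.
Qed.

Lemma cantor_gap_sub n k x : in_cantor_gap n k x -> in_cantor_itv n k x.
Proof. by rewrite /in_cantor_gap /in_cantor_itv; have := ell_gt0 n.+1; lra. Qed.

Lemma cantor_gap_itv n k j x : in_cantor_gap n k x -> ~ in_cantor_itv n.+1 j x.
Proof.
move=> gx ix; have jk := cantor_itv_uniq (cantor_itv_parent ix) (cantor_gap_sub gx).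
by move: gx ix; rewrite /in_cantor_gap /in_cantor_itv /= jk {jk}; case: (odd j) => *; lra.
Qed.

Lemma cantor_gap_uniq n k m j x :
  in_cantor_gap n k x -> in_cantor_gap m j x -> n = m /\ k = j.
Proof.
wlog nm : n k m j / (n <= m)%N => [hw nkx mjx|nkx mjx].
  by case: (leqP n m) => [/hw|/ltnW/hw] H; [apply: H|case: (H _ _ mjx nkx)].
move: nm; rewrite leq_eqVlt => /predU1P[nm|nm].
  rewrite -nm in mjx *; split=> //.
  exact: (cantor_itv_uniq (cantor_gap_sub nkx) (cantor_gap_sub mjx)).
have := cantor_gap_sub mjx; rewrite -(subnK nm).
by move/cantor_itv_ancestor/(cantor_gap_itv nkx).
Qed.

(** If x is in no gap, it never leaves the intervals: at each generation it is
    to the left or to the right of the gap of its interval. *)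
Lemma cantor_itv_or_gap x : 0 <= x <= 1 ->
  (forall n, exists2 k, (k < 2 ^ n)%N & in_cantor_itv n k x) \/
  (exists n k, (k < 2 ^ n)%N /\ in_cantor_gap n k x).
Proof.
move=> x01; have [?|ngap] := pselect (exists n k, (k < 2 ^ n)%N /\ in_cantor_gap n k x).
  by right.
left; elim=> [|n [k kn kx]].
  by exists 0%N => //; rewrite /in_cantor_itv /= ell0 add0r.
have [xl|xl] := leP x (cantor_left n k + ell n.+1).
  exists k.*2; first by rewrite expnS; lia.
  move: kx; rewrite /in_cantor_itv /= odd_double doubleK.
  by lra.
have [xr|xr] := leP (cantor_left n k + (ell n - ell n.+1)) x.
  exists k.*2.+1; first by rewrite expnS; lia.
  move: kx; rewrite /in_cantor_itv /= odd_double /= uphalf_double.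
  by lra.
by exfalso; apply: ngap; exists n, k; rewrite /in_cantor_gap xl xr.
Qed.

Lemma dyadic_digits_half n x : (dyadic_digits n.+1 x)./2 = dyadic_digits n x.
Proof.
rewrite /dyadic_digits exprS -mulrA; set y := _ * x.
have [y0|y0] := ltP y 0.
  have y20 : 2 * y < 0 by lra.
  by rewrite !truncn_floor !leNgt y0 y20.
have y20 : 0 <= 2 * y by lra.
apply/esym/truncn_def; have := truncn_itv y20.
set t := Num.truncn _; rewrite -{1 2}(odd_double_half t).
rewrite -addn1 !natrD -!muln2 !natrM; case: (odd t) => /=; lra.
Qed.

Lemma dyadic_digits_div m n x : (dyadic_digits (m + n) x %/ 2 ^ m)%N = dyadic_digits n x.
Proof.
elim: m => [|m IH]; first by rewrite divn1.
by rewrite addSn expnS divnMA divn2 dyadic_digits_half.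
Qed.

Lemma dyadic_digits_lt n x : x < 1 -> (dyadic_digits n x < 2 ^ n)%N.
Proof.
move=> x1; have [x0|x0] := ltP x 0.
  rewrite /dyadic_digits truncn_floor leNgt pmulr_rlt0 ?exprn_gt0// x0 /=.
  by rewrite expn_gt0.
rewrite truncn_lt_nat ?mulr_ge0 ?exprn_ge0// natrX.
by rewrite gtr_pMr// exprn_gt0.
Qed.

Lemma cantor_fun_bound m n x :
  cantor_left m (dyadic_digits m x) <=
  cantor_left n (dyadic_digits n x) + ell n.
Proof.
have [mn|/ltnW nm] := leqP m n.
  have := cantor_left_in n (dyadic_digits n x).
  rewrite -{1}(subnK mn) => /cantor_itv_ancestor/andP[+ _].
  have := dyadic_digits_div (n - m) m x; rewrite subnK// => ->.
  by move=> /le_trans; apply; rewrite lerDl ltW.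
have := cantor_left_in m (dyadic_digits m x).
rewrite -{1}(subnK nm) => /cantor_itv_ancestor/andP[_ +].
by have := dyadic_digits_div (m - n) n x; rewrite subnK// => ->.
Qed.

(** The intervals met along the binary expansion of x are nested, hence the left
    end of each one bounds from below the right end of all the others. *)
Lemma cantor_fun_in n x : in_cantor_itv n (dyadic_digits n x) (cantor_fun x).
Proof.
apply/andP; split.
  apply: ub_le_sup; last by exists n.
  by exists (cantor_left 0 (dyadic_digits 0 x) + ell 0) => _ [m _ <-]; exact: cantor_fun_bound.
apply: ge_sup; first by exists (cantor_left 0 (dyadic_digits 0 x)); exists 0%N.
by move=> _ [m _ <-]; exact: cantor_fun_bound.
Qed.

Lemma dyadic_digits_homo n : {homo dyadic_digits n : x y / x <= y >-> (x <= y)%N}.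
Proof.
by move=> x y xy; apply: le_truncn; rewrite ler_wpM2l// exprn_ge0.
Qed.

Lemma cantor_fun_homo : {homo cantor_fun : x y / x <= y}.
Proof.
move=> x y xy; apply: ge_sup.
  by exists (cantor_left 0 (dyadic_digits 0 x)); exists 0%N.
move=> _ [n _ <-]; have /andP[+ _] := cantor_fun_in n y.
by apply: le_trans; apply: cantor_left_homo; exact: dyadic_digits_homo.
Qed.

Lemma cantor_fun01 x : x < 1 -> 0 <= cantor_fun x <= 1.
Proof.
by move=> x1; exact: (in_cantor_itv01 (dyadic_digits_lt 0 x1) (cantor_fun_in 0 x)).
Qed.

Lemma cantor_fun_not_gap n k x : ~ in_cantor_gap n k (cantor_fun x).
Proof. by move=> /cantor_gap_itv; apply; exact: cantor_fun_in. Qed.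

(** ** The Cantor set on the circle and its complementary arcs *)

Definition gap_arc n k : set (circle R) :=
  @circle_param R @` `]cantor_left n k + ell n.+1, cantor_left n k + (ell n - ell n.+1)[.

Definition cantor_arc n k : set (circle R) :=
  @circle_param R @` `[cantor_left n k, cantor_left n k + ell n].

Definition gap_index : set (nat * nat) := [set p | (p.2 < 2 ^ p.1)%N].

(** Defining the Cantor set by its gaps makes it closed at once, and reduces
    the description of its complementary arcs to the disjointness of the gaps. *)
Definition cantor_set : set (circle R) :=
  ~` \bigcup_(p in gap_index) gap_arc p.1 p.2.

Lemma cantor_gap_in01 n k x : (k < 2 ^ n)%N -> in_cantor_gap n k x -> 0 < x < 1.
Proof.
move=> kn; have /(in_cantor_itv01 kn)/andP[l0 _] := cantor_left_in n k.
have /(in_cantor_itv01 kn)/andP[_ r1] := cantor_right_in n k.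
by rewrite /in_cantor_gap; have := ell_gt0 n.+1; lra.
Qed.

Lemma gap_arc_param n k x : (k < 2 ^ n)%N -> 0 <= x <= 1 ->
  gap_arc n k (circle_param x) <-> in_cantor_gap n k x.
Proof.
move=> kn x01; split => [[y /=]|xg]; last by exists x => //=; rewrite in_itv.
rewrite in_itv/= => yg; have y01 := cantor_gap_in01 kn yg.
move/circle_param_inj => <- //.
by rewrite ltr_norml; lra.
Qed.

Lemma cantor_set_param x : 0 <= x <= 1 ->
  cantor_set (circle_param x) <->
  (forall n k, (k < 2 ^ n)%N -> ~ in_cantor_gap n k x).
Proof.
move=> x01; split => [Ex n k kn /(gap_arc_param kn x01) xg|H].
  by apply: Ex; exists (n, k).
by move=> [[n k] /= kn] /(gap_arc_param kn x01); exact: H.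
Qed.

Lemma cantor_set_itv n xi : cantor_set xi -> exists x k,
  [/\ 0 <= x < 1, (k < 2 ^ n)%N, in_cantor_itv n k x & circle_param x = xi].
Proof.
have [x x01 <-] := circle_param_surj xi; have x01' : 0 <= x <= 1 by lra.
move=> /(cantor_set_param x01') Ex.
have [/(_ n)[k kn kx]|[m [k [km kx]]]] := cantor_itv_or_gap x01'.
  by exists x, k.
by exfalso; exact: Ex km kx.
Qed.

Lemma open_gap_arc n k : (k < 2 ^ n)%N -> open (gap_arc n k).
Proof.
move=> kn; have /(in_cantor_itv01 kn)/andP[l0 _] := cantor_left_in n k.
have /(in_cantor_itv01 kn)/andP[_ r1] := cantor_right_in n k.
by apply: open_circle_arc; have := ell_gt0 n.+1; lra.
Qed.

Lemma closed_cantor_set : closed cantor_set.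
Proof.
by apply: open_closedC; apply: bigcup_open => -[n k] kn; exact: open_gap_arc.
Qed.

Lemma gap_arc_uniq n k m j xi : (k < 2 ^ n)%N -> (j < 2 ^ m)%N ->
  gap_arc n k xi -> gap_arc m j xi -> n = m /\ k = j.
Proof.
move=> kn jm; have [x x01 <-] := circle_param_surj xi.
have x01' : 0 <= x <= 1 by lra.
move=> /(gap_arc_param kn x01') xk /(gap_arc_param jm x01') xj.
exact: (cantor_gap_uniq xk xj).
Qed.

Lemma gap_arc_neq0 n k : gap_arc n k !=set0.
Proof.
exists (circle_param (cantor_left n k + ell n / 2)); exists (cantor_left n k + ell n / 2) => //=.
by rewrite in_itv/=; have := ell_half n; lra.
Qed.

Lemma connected_gap_arc n k : connected (gap_arc n k).
Proof.
apply: connected_continuous_connected.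
  by apply/connected_intervalP; exact: interval_is_interval.
by apply: continuous_subspaceT; exact: circle_param_continuous.
Qed.

(** A gap is connected, open, and also closed in the complement of the Cantor
    set since the other gaps are open. *)
Lemma component_gap_arc n k xi : (k < 2 ^ n)%N -> gap_arc n k xi ->
  connected_component (~` cantor_set) xi = gap_arc n k.
Proof.
move=> kn xik; apply/seteqP; split; last first.
  apply: connected_component_max => //; last exact: connected_gap_arc.
  by rewrite /cantor_set setCK => z zk; exists (n, k).
set J := connected_component _ _.
have Jxi : J xi.
  by apply: connected_component_refl; rewrite /cantor_set setCK; exists (n, k).
suff <- : J `&` gap_arc n k = J by move=> z [].
apply: (component_connected (A := ~` cantor_set) (x := xi)).
- by exists xi.
- by exists (gap_arc n k) => //; exact: open_gap_arc.
exists (~` \bigcup_(p in gap_index `&` [set~ (n, k)]) gap_arc p.1 p.2).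
  by apply: open_closedC; apply: bigcup_open => -[m j] [jm _]; exact: open_gap_arc.
apply/seteqP; split => z [Jz zk]; split => //.
  move=> [[m j] /= [jm neq] /= zj]; apply: neq.
  by have [-> ->] := gap_arc_uniq (jm : (j < 2 ^ m)%N) kn zj zk.
have := connected_component_sub Jz; rewrite /cantor_set setCK => -[[m j] jm zj].
have [[<- <-//]|neq] := pselect ((m, j) = (n, k)).
by exfalso; apply: zk; exists (m, j).
Qed.

Lemma complementary_arcs_cantor :
  complementary_arcs cantor_set = (fun p => gap_arc p.1 p.2) @` gap_index.
Proof.
apply/seteqP; split => [_ [xi Exi <-]|_ [[n k] kn <-]].
  have := Exi; rewrite /cantor_set setCK => -[[n k] kn xik]; exists (n, k) => //.
  by rewrite -(component_gap_arc kn xik) /cantor_set setCK.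
have [xi xik] := gap_arc_neq0 n k.
exists xi; last exact: component_gap_arc.
by rewrite /cantor_set setCK; exists (n, k).
Qed.

Lemma measurable_cantor_set : measurable cantor_set.
Proof. by apply: closed_measurable_circle; exact: closed_cantor_set. Qed.

Lemma measurable_cantor_arc n k : measurable (cantor_arc n k).
Proof. by apply: closed_measurable_circle; exact: closed_circle_arc. Qed.

Lemma cantor_set_sub n : cantor_set `<=` \bigcup_(k < 2 ^ n) cantor_arc n k.
Proof.
move=> xi /(cantor_set_itv n)[x [k [_ kn kx <-]]]; exists k => //.
by exists x => //=; rewrite in_itv.
Qed.

Lemma arclength_gap_arc_le n k : (k < 2 ^ n)%N ->
  (arclength (gap_arc n k) <= (ell n)%:E)%E.
Proof.
move=> kn; have /(in_cantor_itv01 kn)/andP[l0 _] := cantor_left_in n k.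
have /(in_cantor_itv01 kn)/andP[_ r1] := cantor_right_in n k.
have l1 := ell_gt0 n.+1; have l2 := ell_half n.
apply: le_trans (arclength_arc_le _ _ _) _; rewrite ?lee_fin; lra.
Qed.

Lemma arclength_cantor_set_le n :
  (arclength cantor_set <= (2 ^+ n * ell n)%:E)%E.
Proof.
pose B k : set R := `[cantor_left n k, cantor_left n k + ell n]%classic.
have mB N : measurable (\big[setU/set0]_(k < N) B k) by apply: bigsetU_measurable => k _; exact: measurable_itv.
apply: (@le_trans _ _ (@lebesgue_measure R (\big[setU/set0]_(k < (2 ^ n)%N) B k))).
  apply: arclength_le => //; first exact: measurable_cantor_set.
  move=> x [] /= Ex; rewrite in_itv/= => x01.
  have [y [k [y01 kn ky yx]]] := cantor_set_itv n Ex.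
  have <- : y = x by apply: circle_param_inj => //; rewrite ltr_norml; lra.
  by rewrite -bigcup_mkord; exists k => //=; rewrite in_itv.
apply: (@le_trans _ _ (\sum_(k < (2 ^ n)%N) @lebesgue_measure R (B k))%E).
  by apply: content_subadditive; [move=> k _; exact: measurable_itv|exact: mB|].
rewrite (eq_bigr (fun=> (ell n)%:E)); last first.
  move=> k _; rewrite lebesgue_measure_itv/= lte_fin ltrDl ell_gt0.
  by rewrite -EFinB; congr EFin; lra.
by rewrite sumEFin sumr_const card_ord -natrX mulr_natl.
Qed.

(** The 2^n gaps of generation n are shorter than l_n. *)
Lemma esum_complementary_arcs_le (theta c : R) (u : nat -> R) : 0 < theta ->
  (forall n, 2 ^+ n * ell n `^ theta <= u n) ->
  (forall n, \sum_(0 <= i < n) u i <= c) ->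
  (\esum_(J in complementary_arcs cantor_set) (arclength J `^ theta) <= c%:E)%E.
Proof.
move=> theta0 hu hc; rewrite complementary_arcs_cantor esum_image; last first.
  move=> [n k] [m j] /set_mem /= kn /set_mem /= jm E.
  have [xi xik] := gap_arc_neq0 n k.
  have xij := xik; rewrite E in xij.
  by have [-> ->] := gap_arc_uniq (kn : (k < 2 ^ n)%N) (jm : (j < 2 ^ m)%N) xik xij.
have -> : gap_index = setT `*`` (fun n => `I_(2 ^ n)).
  by apply/seteqP; split => -[n k] //= [].
rewrite -(@esum_esum _ _ _ setT (fun n => `I_(2 ^ n)) (fun n k => arclength (gap_arc n k) `^ theta)%E); last first.
  by move=> *; exact: poweR_ge0.
apply: (@le_trans _ _ (\esum_(n in setT) (u n)%:E)%E).
  apply: le_esum => n _; rewrite esum_fset//; last by move=> *; exact: poweR_ge0.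
  rewrite -fsbig_ord; apply: (@le_trans _ _ (\sum_(k < 2 ^ n) (ell n `^ theta)%:E)%E).
    apply: lee_sum => k _; rewrite -poweR_EFin.
    apply: gt0_ler_poweR; rewrite ?(ltW theta0)//.
    - by rewrite in_itv/= measure_ge0 leey.
    - by rewrite in_itv/= leey andbT lee_fin ltW.
    - exact: arclength_gap_arc_le.
  by rewrite sumEFin sumr_const card_ord lee_fin -mulr_natl natrX.
have u0 n : 0 <= u n by apply: le_trans (hu n); rewrite mulr_ge0 ?exprn_ge0 ?powR_ge0.
rewrite -nneseries_esumT; last by move=> n; rewrite lee_fin.
apply: lime_le; first by apply: is_cvg_nneseries => n *; rewrite lee_fin.
by apply: nearW => n; rewrite sumEFin lee_fin.
Qed.

(** ** Radial means over the gaps *)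

Definition gap_length n : R := ell n - 2 * ell n.+1.

(** The middle half of a gap: a quarter of the gap on either side keeps it away
    from the Cantor set. *)
Definition mid_arc n k : set (circle R) :=
  @circle_param R @` `[cantor_left n k + ell n / 2 - gap_length n / 4,
                       cantor_left n k + ell n / 2 + gap_length n / 4].

Lemma gap_length_gt0 n : 0 < gap_length n.
Proof. by rewrite subr_gt0 ell_half. Qed.

Lemma mid_arc_sub n k : mid_arc n k `<=` gap_arc n k.
Proof.
move=> _ [x /= + <-]; rewrite in_itv/= => xm; exists x => //=; rewrite in_itv/=.
by move: xm (gap_length_gt0 n); rewrite /gap_length; lra.
Qed.

Lemma measurable_mid_arc n k : measurable (mid_arc n k).
Proof. by apply: closed_measurable_circle; exact: closed_circle_arc. Qed.

Lemma mid_arc_in01 n k : (k < 2 ^ n)%N ->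
  gap_length n / 4 <= cantor_left n k + ell n / 2 - gap_length n / 4 /\
  cantor_left n k + ell n / 2 + gap_length n / 4 <= 1 - gap_length n / 4.
Proof.
move=> kn; have /(in_cantor_itv01 kn)/andP[l0 _] := cantor_left_in n k.
have /(in_cantor_itv01 kn)/andP[_ r1] := cantor_right_in n k.
by have := ell_gt0 n.+1; have := gap_length_gt0 n; rewrite /gap_length; lra.
Qed.

Lemma arclength_mid_arc_ge n k : (k < 2 ^ n)%N ->
  ((gap_length n / 2)%:E <= arclength (mid_arc n k))%E.
Proof.
move=> /mid_arc_in01[h1 h2]; have g0 := gap_length_gt0 n.
apply: le_trans (arclength_arc_ge _ _ _); [rewrite lee_fin; lra|lra|lra|lra].
Qed.

(** A quarter of the gap separates [mid_arc] from the ends of the gap, hence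
    also from the ends of [0, 1]: this keeps the Cantor set away on both sides
    around the circle. *)
Lemma chord_mid_arc_ge n k zeta xi : (k < 2 ^ n)%N -> mid_arc n k xi ->
  cantor_set zeta -> 1 - cos (2 * pi * (gap_length n / 4)) <= chord zeta xi.
Proof.
move=> kn [x /= + <-]; rewrite in_itv/= => xm.
have [y y01 <-] := circle_param_surj zeta; have y01' : 0 <= y <= 1 by lra.
move=> /(cantor_set_param y01')/(_ n k kn)/negP.
rewrite /in_cantor_gap negb_and -!leNgt => yg.
have [h1 h2] := mid_arc_in01 kn; have g0 := gap_length_gt0 n.
apply: chord_ge; first lra.
have gE : gap_length n = ell n - 2 * ell n.+1 by [].
case/orP: yg => yg.
  by rewrite ler0_norm; lra.
by rewrite ger0_norm; lra.
Qed.

Lemma chord_mid_arc_le n k zeta xi : mid_arc n k xi -> cantor_arc n k zeta ->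
  chord zeta xi <= (2 * pi * ell n) ^+ 2 / 2.
Proof.
move=> [x /= + <-] [y /= + <-]; rewrite !in_itv/= => xm yk; apply: chord_le.
have := gap_length_gt0 n; have := ell_gt0 n.+1; move: xm; rewrite /gap_length ler_norml; lra.
Qed.

(** A radius close to 1 can serve finitely many generations at a time only,
    because the gaps shrink. *)
Lemma mid_arcs_separated N : exists2 kappa : R, 0 < kappa &
  forall n, (n < N)%N -> kappa <= 1 - cos (2 * pi * (gap_length n / 4)).
Proof.
elim: N => [|N [kappa k0 IH]]; first by exists 1.
exists (Num.min kappa (1 - cos (2 * pi * (gap_length N / 4)))).
  rewrite lt_min k0 subr_gt0 cos_2pi_lt1// divr_gt0 ?gap_length_gt0//=.
  have := @mid_arc_in01 N 0 (expn_gt0 _ _); have := gap_length_gt0 N; lra.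
by move=> n; rewrite ltnS leq_eqVlt => /predU1P[->|/IH h]; rewrite ge_min ?lexx ?orbT// h.
Qed.

Section integral_lower_bound.
Context (nu : {finite_measure set (circle R) -> \bar R}) (s : R).
Context (s_gt0 : 0 < s) (s_lt1 : s < 1).
Context (nu_supp : nu (~` cantor_set) = 0%E).
Context (nu_arc : forall n k, (k < 2 ^ n)%N ->
  (nu (cantor_arc n k) <= (3 / 2 ^+ n)%:E)%E).

Let A n k := cantor_arc n k `&` cantor_set.
Let v n k : R := fine (nu (A n k)).
Let m : R := fine (nu setT).

Let mA n k : measurable (A n k).
Proof. by apply: measurableI; [exact: measurable_cantor_arc|exact: measurable_cantor_set]. Qed.

Let v_ge0 n k : 0 <= v n k. Proof. exact: fine_ge0. Qed.

Let v_le n k : (k < 2 ^ n)%N -> v n k <= 3 / 2 ^+ n.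
Proof.
move=> kn; rewrite -lee_fin fineK ?fin_num_measure//.
apply: le_trans (nu_arc kn); apply: le_measure; last by move=> x [].
  by apply: mem_set; exact: mA.
by apply: mem_set; exact: measurable_cantor_arc.
Qed.

Let sum_v_ge n : m <= \sum_(0 <= k < 2 ^ n) v n k.
Proof.
have -> : m = fine (nu cantor_set).
  have mE := measurable_cantor_set; have mCE := measurableC mE.
  rewrite /m -(setUv cantor_set) (measureU nu mE mCE) ?setICr//.
  by congr fine; rewrite -[RHS]adde0; congr (_ + _)%E; exact: nu_supp.
rewrite -lee_fin fineK ?fin_num_measure//; last exact: measurable_cantor_set.
rewrite -sumEFin big_mkord.
under eq_bigr do rewrite fineK ?fin_num_measure//.
apply: content_subadditive => //; first exact: measurable_cantor_set.
move=> xi Exi; rewrite -(@bigcup_mkord _ (2 ^ n) (A n)).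
by have [k kn kxi] := cantor_set_sub n Exi; exists k.
Qed.

(** The power s < 1 is steep near 0: since v <= 3 / 2^n, the quotient
    v^s / v = v^(s-1) is at least (3 / 2^n)^(s-1). *)
Let sum_v_powR_ge n :
  m * (3 / 2 ^+ n) `^ (s - 1) <= \sum_(0 <= k < 2 ^ n) v n k `^ s.
Proof.
apply: le_trans (ler_wpM2r (powR_ge0 _ _) (sum_v_ge n)) _.
rewrite mulr_suml big_nat [leRHS]big_nat; apply: ler_sum => k /andP[_ kn].
have [->|v0] := eqVneq (v n k) 0; first by rewrite mul0r powR_ge0.
rewrite -(mulr_powRB1 (v_ge0 n k) s_gt0) ler_wpM2l//.
have v0' : 0 < v n k by rewrite lt_neqAle eq_sym v0 v_ge0.
rewrite -opprB !powRN lef_pV2 ?posrE ?powR_gt0 ?divr_gt0 ?exprn_gt0//.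
by apply: ge0_ler_powR; rewrite ?nnegrE ?v_ge0 ?divr_ge0 ?exprn_ge0 ?v_le ?subr_ge0 ?(ltW s_lt1).
Qed.

(** The radius depends on N, the constant in front of the sum does not: letting
    N grow makes the radial means unbounded when the sum diverges. *)
Lemma radial_integral_ge N :
  holomorphic_disk (derive1 (singular_inner nu)) ->
  exists2 r : R, r \in `]0, 1[ &
  (((expR (- m) / (9 * pi ^+ 2)) `^ s * (3 `^ (s - 1) * m / 2) *
    (\sum_(0 <= n < N) gap_length n * ell n `^ (- (2 * s)) * (2 ^+ n) `^ (1 - s)))%:E <=
  \int[@arclength R]_xi (complex.Re
     `|derive1 (singular_inner nu) ((r%:C)%C * circle_val xi)| `^ s)%:E)%E.
Proof.
move=> hol; have p0 := pi_gt0 R.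
(* The radius is fixed first; it suits all gaps of generation below N. *)
have [kappa k0 kN] := mid_arcs_separated N.
have [r [r01 rk1 rk2]] := radius_near1 k0.
exists r; first by rewrite in_itv.
pose c0 := expR (- m) / (9 * pi ^+ 2).
have c00 : 0 < c0 by rewrite divr_gt0 ?expR_gt0// mulr_gt0// exprn_gt0.
pose c (p : nat * nat) : R := (c0 * ell p.1 ^- 2 * v p.1 p.2) `^ s.
pose idx := [seq (n, k) | n <- iota 0 N, k <- iota 0 (2 ^ n)].
have idxP p : p \in idx -> (p.1 < N)%N /\ (p.2 < 2 ^ p.1)%N.
  by move=> /allpairsPdep[n [k []]]; rewrite !mem_iota /= !add0n => nN kn ->.
apply: le_trans (integral_ge_disjoint (@arclength R) (s := idx)
  (A := fun p => mid_arc p.1 p.2) (c := c) _ _ _ _ _ _ _); first last.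
- move=> [n k] xi /idxP[/= nN kn] xik; rewrite lee_fin.
  apply: ge0_ler_powR; rewrite ?nnegrE ?(ltW s_gt0)//.
  + apply: mulr_ge0 (v_ge0 _ _); apply: mulr_ge0; first exact: ltW.
    by rewrite invr_ge0 exprn_ge0 ?(ltW (ell_gt0 _)).
  + exact: normc_ge0.
  have X0 : 0 < (2 * pi * ell n) ^+ 2 / 2 by rewrite divr_gt0// exprn_gt0// !mulr_gt0.
  apply: le_trans (singular_inner_derive1_ge measurable_cantor_set (mA n k) _ nu_supp
    r01 k0 _ _ rk1 rk2 X0).
  (* The constant: 2 / (9 X) with X = (2 pi l)^2 / 2 is 1 / (9 pi^2 l^2). *)
  + have constE (e q l w : R) : 0 < q -> 0 < l ->
        e / (9 * q ^+ 2) / l ^+ 2 * w = e * (2 / (9 * ((2 * q * l) ^+ 2 / 2)) * w).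
      by move=> q0 l0; field; rewrite !gt_eqF.
    by rewrite -(constE _ _ _ (v n k) p0 (ell_gt0 n)).
  + by move=> xi' [].
  + move=> zeta Ezeta; apply: le_trans (kN _ nN) _.
    exact: chord_mid_arc_ge kn xik Ezeta.
  + by move=> zeta [Azeta _]; exact: chord_mid_arc_le xik Azeta.
- by move=> p; exact: powR_ge0.
- move=> [n k] [n' k'] /= /idxP[_ kn] /idxP[_ kn'] [xi [/mid_arc_sub xik /mid_arc_sub xik']].
  by have [/= -> ->] := gap_arc_uniq kn kn' xik xik'.
- apply: allpairs_uniq_dep; first exact: iota_uniq.
  + by move=> n _; exact: iota_uniq.
  + by move=> [n k] [n' k'] _ _ [-> ->].
- by move=> p; exact: measurable_mid_arc.
- by move=> xi; rewrite lee_fin powR_ge0.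
- exact: holomorphic_radial_measurable hol r01.
apply: (@le_trans _ _ (\sum_(p <- idx) (c p * (gap_length p.1 / 2))%:E)%E); last first.
  rewrite big_seq [leRHS]big_seq; apply: lee_sum => -[n k] /idxP[/= _ kn].
  by rewrite EFinM lee_wpmul2l ?lee_fin ?powR_ge0// arclength_mid_arc_ge.
rewrite sumEFin lee_fin big_allpairs_dep mulr_sumr.
rewrite /index_iota subn0; apply: ler_sum => n _ /=.
rewrite -mulr_suml.
have e0 := ell_gt0 n.
have -> : \sum_(k <- iota 0 (2 ^ n)) c (n, k) =
    c0 `^ s * ell n `^ (- (2 * s)) * \sum_(0 <= k < 2 ^ n) v n k `^ s.
  rewrite /index_iota subn0 mulr_sumr; apply: eq_bigr => k _; rewrite /c /=.
  have e2 : 0 <= ell n ^- 2 by rewrite invr_ge0 exprn_ge0// ltW.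
  rewrite (powRM s (mulr_ge0 (ltW c00) e2) (v_ge0 n k)) (powRM s (ltW c00) e2).
  congr (_ * _ * _).
  by rewrite -powR_invn ?(ltW e0)// -powRrM mulNr.
have -> : (2 ^+ n) `^ (1 - s) = (2 ^+ n)^-1 `^ (s - 1) :> R.
  by rewrite -powR_inv1 ?exprn_ge0// -powRrM mulN1r opprB.
have p2 : 0 <= (2 ^+ n)^-1 :> R by rewrite invr_ge0 exprn_ge0.
have h := sum_v_powR_ge n; rewrite (powRM _ (ler0n R 3) p2) in h.
set a := c0 `^ s; set b := ell n `^ _; set g := gap_length n.
have abg : 0 <= a * b * (g / 2).
  by rewrite !mulr_ge0 ?powR_ge0 ?divr_ge0 ?(ltW (gap_length_gt0 n)).
by have := ler_wpM2l abg h; rewrite -/c0 -/a; lra.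
Qed.

End integral_lower_bound.

(** ** The length of the Cantor set and the Cantor measure *)

Lemma cantor_left0 n : cantor_left n 0 = 0.
Proof. by elim: n => //= n ->; rewrite addr0. Qed.

Lemma arclength_cantor_set rho : 0 <= rho < 1 ->
  (forall n, 2 * ell n.+1 <= rho * ell n) -> arclength cantor_set = 0%E.
Proof.
move=> /andP[rho0 rho1] ratio; apply/eqP; rewrite eq_le measure_ge0 andbT.
apply: (@le_geometric_le0 _ _ 1 rho); [by rewrite rho0|move=> n].
apply: le_trans (arclength_cantor_set_le n) _; rewrite lee_fin mul1r.
elim: n => [|n IH]; first by rewrite ell0 mulr1.
have -> : 2 ^+ n.+1 * ell n.+1 = 2 ^+ n * (2 * ell n.+1) by rewrite exprS; ring.
apply: (@le_trans _ _ (2 ^+ n * (rho * ell n))); first by rewrite ler_pM2l// exprn_gt0.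
by rewrite mulrCA exprS ler_wpM2l.
Qed.

Lemma measurable_cantor_param :
  measurable_fun [set: measurableTypeR R] (@circle_param R \o cantor_fun).
Proof.
apply: measurableT_comp; first exact: measurable_circle_param.
by apply: nondecreasing_measurable => //; exact: cantor_fun_homo.
Qed.

Context (mu : {measure set (circle R) -> \bar R})
  (muE : forall A, mu A =
    @lebesgue_measure R ((@circle_param R \o cantor_fun) @^-1` A `&` `[0, 1[)).

(** Values of [cantor_fun] belong to an interval of each generation, hence to no
    gap. *)
Lemma cantor_measure_supported : mu (~` cantor_set) = 0%E.
Proof.
rewrite muE [X in lebesgue_measure X](_ : _ = set0) ?measure0//.
apply/seteqP; split => // x [/= nE]; rewrite in_itv/= => /andP[_ x1].
apply: nE; apply/cantor_set_param; first exact: cantor_fun01.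
by move=> n k _; exact: cantor_fun_not_gap.
Qed.

Lemma dyadic_cell n j x : 0 <= x -> dyadic_digits n x = j ->
  x \in `[(j%:R / 2 ^+ n), (j.+1%:R / 2 ^+ n)[.
Proof.
move=> x0 <-; have p0 : 0 < 2 ^+ n :> R by rewrite exprn_gt0.
have := truncn_itv (mulr_ge0 (ltW p0) x0).
by rewrite in_itv/= ler_pdivrMr// ltr_pdivlMr// [x * _]mulrC.
Qed.

(** The points of [0, 1[ sent to the k-th interval form the k-th dyadic
    interval, of length 1 / 2^n.  On the circle the points 0 and 1 coincide, so
    the first and the last dyadic intervals may contribute as well: the
    constant 3 saves the study of these end points. *)
Lemma cantor_measure_arc n k : (k < 2 ^ n)%N ->
  (mu (cantor_arc n k) <= (3 / 2 ^+ n)%:E)%E.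
Proof.
move=> kn; rewrite muE; have p0 : 0 < 2 ^+ n :> R by rewrite exprn_gt0.
pose D j : set R := `[(j%:R / 2 ^+ n), (j.+1%:R / 2 ^+ n)[%classic.
pose B i := D (nth 0%N [:: k; 0%N; (2 ^ n).-1] i).
have mB i : measurable (B i) by exact: measurable_itv.
have BE i : @lebesgue_measure R (B i) = (1 / 2 ^+ n)%:E.
  rewrite lebesgue_measure_itv/= lte_fin ltr_pM2r ?invr_gt0// ltr_nat leqnn.
  by rewrite -EFinB -mulrBl -natrB// subSnn.
apply: (@le_trans _ _ (\sum_(i < 3) @lebesgue_measure R (B i))%E); last first.
  under eq_bigr do rewrite BE.
  by rewrite sumEFin sumr_const card_ord lee_fin -mulrnAl.
have mX : measurable ((@circle_param R \o cantor_fun) @^-1` cantor_arc n k `&` `[0, 1[).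
  apply: measurableI => //; rewrite -[X in measurable X]setTI.
  apply: measurable_cantor_param => //; exact: measurable_cantor_arc.
apply: content_subadditive; [by move=> *; exact: mB|exact: mX|].
move=> x [] /= [y /=]; rewrite !in_itv/= => ky yE /andP[x0 x1].
rewrite -(@bigcup_mkord _ 3 B).
have phix := cantor_fun01 x1; have phi_in := cantor_fun_in n x.
have y01 := in_cantor_itv01 kn ky.
have [phi0|phi0] := eqVneq (cantor_fun x) 0.
  exists 1%N => //; apply: dyadic_cell => //.
  apply: (cantor_itv_uniq phi_in); rewrite phi0.
  by have := cantor_left_in n 0; rewrite cantor_left0.
have [phi1|phi1] := eqVneq (cantor_fun x) 1.
  exists 2%N => //; apply: dyadic_cell => //=.
  have := dyadic_digits_lt n x1; set d := dyadic_digits n x => dn.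
  apply/eqP; rewrite eqn_leq; apply/andP; split; first by lia.
  rewrite leqNgt; apply/negP => dl.
  have := cantor_left_sep n dl.
  have := in_cantor_itv01 _ (cantor_left_in n (2 ^ n).-1).
  rewrite ltn_predL expn_gt0 => /(_ isT).
  move: phi_in; rewrite /in_cantor_itv -/d phi1; have := ell_gt0 n; lra.
exists 0%N => //; apply: dyadic_cell => //=.
apply: (cantor_itv_uniq phi_in).
suff <- : y = cantor_fun x by [].
apply: circle_param_inj => //; rewrite ltr_norml; lra.
Qed.

Lemma cantor_measure_nonatomic xi : mu [set xi] = 0%E.
Proof.
have mxi : measurable [set xi].
  apply: closed_measurable_circle; apply: compact_closed; last exact: compact_set1.
  exact: hausdorff_circle.
apply/eqP; rewrite eq_le measure_ge0 andbT.
have [Exi|nExi] := pselect (cantor_set xi); last first.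
  rewrite -cantor_measure_supported; apply: le_measure; rewrite ?inE//.
    by apply: measurableC; exact: measurable_cantor_set.
  by move=> _ ->.
apply: (@le_geometric_le0 _ _ 3 (1 / 2)); first by lra.
move=> n; have [x [k [x01 kn kx xE]]] := cantor_set_itv n Exi.
rewrite mul1r exprVn; apply: le_trans (cantor_measure_arc kn).
apply: le_measure; rewrite ?inE//; first exact: measurable_cantor_arc.
by move=> _ ->; exists x => //=; rewrite in_itv.
Qed.

End cantor_intervals.

(** * The theorem *)

Theorem theorem1p1 (R : realType) (s theta : R)
    (s_gt0 : 0 < s) (s_lt_half : s < 1 / 2)
    (thetaE : theta = (1 - 2 * s) / (1 - s)) :
  exists (E : set (circle R)) (mu : probability (circle R) R),
    [/\ closed E,
        arclength E = 0%E,
        nonatomic mu,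
        singular mu &
        supported_on mu E] /\
    (\esum_(J in complementary_arcs E) (arclength J `^ theta) < +oo)%E /\
    (forall nu : {finite_measure set (circle R) -> \bar R},
        measure_nonzero nu -> measure_le nu mu ->
        ~ hardy s (derive1 (singular_inner nu))).
Proof.
pose ell : nat -> R := critical_length s.
have slt1 : s < 1 by lra.
have s1 : 0 < 1 - s by lra.
have tau0 : 0 < 1 - 2 * s by lra.
have ell0 : ell 0%N = 1 := critical_length0 s.
have ell_gt0 : forall n, 0 < ell n := critical_length_gt0 s.
have [rho0 rho1] := andP (critical_ratio_lt1 s_gt0 s_lt_half).
set rho := critical_ratio s in rho0 rho1.
have ell_ratio n : 2 * ell n.+1 <= rho * ell n by exact: critical_length_ratio.
have ell_half n : 2 * ell n.+1 < ell n.
  by apply: le_lt_trans (ell_ratio n) _; rewrite gtr_pMl.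
have arcE : arclength (cantor_set ell) = 0%E.
  by apply: (arclength_cantor_set ell0 ell_gt0 ell_half (rho := rho)); rewrite ?(ltW rho0).
have mE := measurable_cantor_set ell0 ell_gt0 ell_half.
have [mu muE] := image_probability (measurable_cantor_param ell0 ell_gt0 ell_half).
have muC := cantor_measure_supported ell0 ell_gt0 ell_half muE.
exists (cantor_set ell), mu; split; [split|split].
- exact: closed_cantor_set.
- exact: arcE.
- exact: (cantor_measure_nonatomic ell0 ell_gt0 ell_half muE).
- by exists (cantor_set ell); split; [exact: mE|exact: arcE|exact: muC].
- exact: muC.
- apply: le_lt_trans (esum_complementary_arcs_le (theta := theta) (c := 1 + (s / (1 - s))^-1)
    (u := riemannR (1 + s / (1 - s))) ell0 ell_gt0 ell_half _ _ _) (ltry _).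
  + by rewrite thetaE divr_gt0.
  + by move=> n; rewrite thetaE critical_length_content.
  + by move=> n; apply: riemannR_bounded; rewrite divr_gt0.
move=> nu [A mA nuA] nu_le [hol sup_fin].
have nu_supp : nu (~` cantor_set ell) = 0%E.
  apply/eqP; rewrite eq_le measure_ge0 andbT -muC; apply: nu_le.
  exact: measurableC mE.
have nu_arc n k : (k < 2 ^ n)%N -> (nu (cantor_arc ell n k) <= (3 / 2 ^+ n)%:E)%E.
  move=> kn; apply: le_trans (cantor_measure_arc ell0 ell_gt0 ell_half muE kn).
  by apply: nu_le; exact: measurable_cantor_arc.
have m0 : 0 < fine (nu setT).
  rewrite fine_gt0// ltey_eq fin_num_measure// andbT.
  apply: lt_le_trans (le_measure nu (mem_set mA) (mem_set measurableT) (@subsetT _ _)).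
  by rewrite lt_neqAle eq_sym nuA measure_ge0.
set S := ereal_sup _ in sup_fin.
pose C := (expR (- fine (nu setT)) / (9 * pi ^+ 2)) `^ s * (3 `^ (s - 1) * fine (nu setT) / 2).
have C0 : 0 < C.
  have p0 := pi_gt0 R.
  by rewrite mulr_gt0 ?powR_gt0 ?divr_gt0 ?mulr_gt0 ?powR_gt0 ?expR_gt0 ?exprn_gt0.
have bound N : ((C * ((1 - rho) * \sum_(0 <= n < N) harmonic n))%:E <= S)%E.
  have [r r01 hr] := radial_integral_ge ell0 ell_gt0 ell_half s_gt0
    slt1 nu_supp nu_arc N hol.
  apply: le_trans (ereal_sup_ubound _); last by exists r.
  apply: le_trans hr; rewrite lee_fin ler_pM2l// mulr_sumr; apply: ler_sum => n _.
  rewrite -(critical_length_harmonic s_lt_half) mulrA ler_wpM2r ?powR_ge0//.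
  rewrite powRD; last by rewrite [X in _ ==> ~~ X]gt_eqF// implybT.
  rewrite powRr1 ?(ltW (ell_gt0 n))// mulrA ler_wpM2r ?powR_ge0//.
  by rewrite /gap_length; have := ell_ratio n; rewrite -/(ell n); lra.
have S_fin : S \is a fin_num.
  rewrite fin_numE; apply/andP; split; last by rewrite lt_eqF.
  rewrite gt_eqF//; apply: lt_le_trans (bound 0%N); exact: ltNyr.
have [N] := harmonic_unbounded (fine S / (C * (1 - rho))).
have Crho : 0 < C * (1 - rho) by rewrite mulr_gt0// subr_gt0.
rewrite ltr_pdivrMr//; have := bound N.
by rewrite -(fineK S_fin) lee_fin mulrA [X in X <= _]mulrC leNgt => /negP.
Qed.
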